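(* Let $G$ be the fundamental group of a finite graph of groups. Assume that all the vertex groups have multiple context-free word problem and all the edge groups are finite. Then $G$ has multiple context-free word problem.
   Context: **Linear rewriting functions.** Let $\Sigma$ be a finite alphabet, $\Sigma^*$ the free monoid on $\Sigma$, $\epsilon$ the empty word. A rewriting on variables $X=\{x_1,\dots,x_n\}$ is a word $w\in (X\sqcup\Sigma)^*$; it defines $f_w\colon(\Sigma^* )^n\to\Sigma^*$ by substituting $u_i$ for each occurrence of $x_i$ (if $n=0$, $f_w$ is the constant $w$). A function $f\colon(\Sigma^* )^n\to(\Sigma^* )^m$ is a linear rewriting function if its components are $f_{w_1},\dots,f_{w_m}$ for rewritings $w_1,\dots,w_m$ on $X$ such that each variable $x_i$ occurs at most once in the concatenation $w_1\cdots w_m$. **Multiple context-free grammars and languages.** A multiple context-free grammar (MCFG) is a tuple $H=(\Sigma,N,S,F)$ where $\Sigma$ is a finite set (terminals); $N$ is a finite set (non-terminals) with a dimension function $\|\cdot\|\colon N\to\{1,2,\dots\}$; $S\in N$ with $\|S\|=1$; and $F$ is a finite set of rules $A\to f(B_1,\dots,B_s)$ with $s\ge 0$, $A,B_1,\dots,B_s\in N$ and $f\colon(\Sigma^* )^{\|B_1\|+\dots+\|B_s\|}\to(\Sigma^* )^{\|A\|}$ a linear rewriting function. The sets $D_H(A)\subseteq(\Sigma^* )^{\|A\|}$, $A\in N$, are defined inductively as the smallest sets such that whenever $A\to f(B_1,\dots,B_s)$ is a rule and $y_i\in D_H(B_i)$ for $i=1,\dots,s$, then $f(y_1,\dots,y_s)\in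 D_H(A)$ (for $s=0$ the constant value of $f$ lies in $D_H(A)$). A language $L\subseteq\Sigma^*$ is multiple context-free if $L=D_H(S)$ for some MCFG $H$. **Word problem.** For a finitely generated group $G$ and a finite set $\Sigma$ of generators (closed under inverses), the word problem of $G$ is the set of words in $\Sigma^*$ representing the identity of $G$. $G$ has multiple context-free word problem if it is finitely generated and this language is multiple context-free for some (equivalently, every) finite generating set $\Sigma$. *)

(* Defs.v *)
From HB Require Import structures.
From mathcomp Require Import all_boot all_order finmap.
From mathcomp Require Import boolp classical_sets cardinality.

Set Implicit Arguments.
Unset Strict Implicit.
Unset Printing Implicit Defensive.

(* In the MathComp library; [groupType] covers infinite groups. *)

Local Open Scope quotient_scope.
Local Open Scope classical_set_scope.
Local Open Scope nat_scope.

Section Rewriting.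
Variable Sigma : finType.

Notation word := (seq Sigma).

(* [inl i] is the variable x_i, [inr a] the terminal a. *)
Definition rewriting (n : nat) := seq ('I_n + Sigma).

Definition substitute n (u : word ^ n) (w : rewriting n) : word :=
  flatten [seq match c with inl i => u i | inr a => [:: a] end | c <- w].

Definition linear_rewriting_function n m (f : word ^ n -> word ^ m) : Prop :=
  exists w : 'I_m -> rewriting n,
    (forall i : 'I_n,
        count_mem (inl i) (flatten [seq w j | j <- enum 'I_m]) <= 1) /\
    (forall u, f u = [ffun j => substitute u (w j)]).

End Rewriting.

Section Grammar.
Variable Sigma : finType.

Notation word := (seq Sigma).

(* The rule A -> f(B_1, ..., B_s), with A = rule_lhs and s = rule_arity. *)
Record mcfg_rule (N : finType) (dim : N -> nat) := MCFGRule {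
  rule_lhs : N;
  rule_arity : nat;
  rule_rhs : 'I_rule_arity -> N;
  rule_fun : word ^ (\sum_i dim (rule_rhs i)) -> word ^ (dim rule_lhs);
  rule_linear : linear_rewriting_function rule_fun
}.

Record mcfg := MCFG {
  nonterminal : finType;
  dimension : nonterminal -> nat;
  dimension_gt0 : forall A, 0 < dimension A;
  start : nonterminal;
  dimension_start : dimension start = 1;
  rules : set (mcfg_rule dimension);
  rules_finite : finite_set rules
}.

(* The tuple (y_1, ..., y_s), flattened: tagnat.sig1 k and tagnat.sig2 k are   *)
(* the block in which k lies and its position within that block.               *)
Definition concat_tuples s (d : 'I_s -> nat) (y : forall i, word ^ (d i)) :
    word ^ (\sum_i d i) :=
  [ffun k => y (tagnat.sig1 k) (tagnat.sig2 k)].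

Inductive derives (H : mcfg) :
    forall A : nonterminal H, word ^ (dimension A) -> Prop :=
| derives_rule (r : mcfg_rule (@dimension H))
    (y : forall i, word ^ (dimension (rule_rhs (m:=r) i))) :
    rules r ->
    (forall i, derives (y i)) ->
    derives (rule_fun (concat_tuples y)).

Definition mcfg_language (H : mcfg) : set word :=
  [set w | derives (A := start H) [ffun=> w]].

Definition multiple_context_free (L : set word) : Prop :=
  exists H : mcfg, L = mcfg_language H.

End Grammar.

Section WordProblem.
Variable G : groupType.

Definition word_value (S : {fset G}) (w : seq S) : G :=
  (\prod_(s <- w) val s)%g.

(* S is closed under inverses, so words over S already give the whole          *)
(* subgroup generated by S.                                                    *)
Definition symmetric_generating_set (S : {fset G}) : Prop :=
  (forall x, x \in S -> x^-1%g \in S) /\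
  (forall g : G, exists w : seq S, word_value w = g).

Definition word_problem (S : {fset G}) : set (seq S) :=
  [set w | word_value w = 1%g].

Arguments word_problem S _ : clear implicits.

Definition has_mcf_word_problem : Prop :=
  exists2 S : {fset G}, symmetric_generating_set S
    & multiple_context_free (word_problem S).

End WordProblem.

Arguments word_problem {G} S _.

(* The underlying graph is given by an orientation: each geometric edge occurs *)
(* once in [gedge], from [src e] to [tgt e]; loops and parallel edges are      *)
(* allowed. Connectedness is part of the existence of a spanning tree below.   *)
Record graph_of_groups := GraphOfGroups {
  gvertex : finType;
  gedge : finType;
  src : gedge -> gvertex;
  tgt : gedge -> gvertex;
  vgroup : gvertex -> groupType;
  egroup : gedge -> groupType;
  src_mono : forall e, {multiplicative egroup e -> vgroup (src e)};
  tgt_mono : forall e, {multiplicative egroup e -> vgroup (tgt e)};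
  src_mono_inj : forall e, injective (src_mono e);
  tgt_mono_inj : forall e, injective (tgt_mono e)
}.

Section FundamentalGroup.
Variable GG : graph_of_groups.

(* (e, true) is e traversed from src to tgt, (e, false) its reverse. *)
Definition dart := (gedge GG * bool)%type.
Definition dart_origin (d : dart) := if d.2 then src d.1 else tgt d.1.
Definition dart_end (d : dart) := if d.2 then tgt d.1 else src d.1.

Fixpoint walk (T : {set gedge GG}) (u : gvertex GG) (p : seq dart)
    (v : gvertex GG) : bool :=
  if p is d :: p' then
    [&& d.1 \in T, dart_origin d == u & walk T (dart_end d) p' v]
  else u == v.

Definition spanning_tree (T : {set gedge GG}) : Prop :=
  [/\ 0 < #|gvertex GG|,
      forall u v, exists p, walk T u p v
    & forall u p, walk T u p u -> uniq [seq d.1 | d <- p] -> p = [::]].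

Definition gletter := ({v : gvertex GG & vgroup v} + dart)%type.

Definition vlet (v : gvertex GG) (g : vgroup v) : gletter :=
  inl (Tagged (@vgroup GG) g).
Definition elet (e : gedge GG) (b : bool) : gletter := inr (e, b).

Variable T : {set gedge GG}.

(* The defining relations of pi_1(GG, T); the stable letter e of each edge     *)
(* satisfies e^-1 * src_mono(a) * e = tgt_mono(a).                             *)
Inductive pi1_relation : seq gletter -> seq gletter -> Prop :=
| rel_vmul v (g h : vgroup v) :
    pi1_relation [:: vlet g; vlet h] [:: vlet (g * h)%g]
| rel_vone v : pi1_relation [:: vlet (1%g : vgroup v)] [::]
| rel_einv e b : pi1_relation [:: elet e b; elet e (~~ b)] [::]
| rel_econj e (a : egroup e) :
    pi1_relation [:: elet e false; vlet (src_mono e a); elet e true]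
                 [:: vlet (tgt_mono e a)]
| rel_tree e : e \in T -> pi1_relation [:: elet e true] [::].

Inductive pi1_congruence : seq gletter -> seq gletter -> Prop :=
| cong_rel p q x y : pi1_relation x y ->
    pi1_congruence (p ++ x ++ q) (p ++ y ++ q)
| cong_refl x : pi1_congruence x x
| cong_sym x y : pi1_congruence x y -> pi1_congruence y x
| cong_trans y x z :
    pi1_congruence x y -> pi1_congruence y z -> pi1_congruence x z.

Definition pi1_equiv (x y : seq gletter) : bool := `[< pi1_congruence x y >].

Lemma pi1_equivP x y : reflect (pi1_congruence x y) (pi1_equiv x y).
Proof. exact: asboolP. Qed.

Lemma pi1_equiv_is_equiv : equiv_class_of pi1_equiv.
Proof.
split=> [x|x y|y x z].
- exact/pi1_equivP/cong_refl.
- by apply/pi1_equivP/pi1_equivP; apply: cong_sym.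
- by move=> /pi1_equivP xy /pi1_equivP yz; apply/pi1_equivP/(cong_trans xy yz).
Qed.

Canonical pi1_equiv_equiv := EquivRelPack pi1_equiv_is_equiv.
Canonical pi1_equiv_encModRel := defaultEncModRel pi1_equiv.

Definition pi1 := {eq_quot pi1_equiv}.

HB.instance Definition _ := Choice.copy pi1 {eq_quot pi1_equiv}.

Definition pi1_class (w : seq gletter) : pi1 := \pi_pi1 w.

Lemma pi1_classP x y : pi1_class x = pi1_class y <-> pi1_congruence x y.
Proof.
by split=> [/eqmodP/pi1_equivP|xy] //; apply/eqmodP/pi1_equivP.
Qed.

Lemma pi1_class_repr a : pi1_class (repr a) = a.
Proof. exact: reprK. Qed.

Lemma pi1_congruence_cat x x' y y' :
  pi1_congruence x x' -> pi1_congruence y y' ->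
  pi1_congruence (x ++ y) (x' ++ y').
Proof.
have catr p z z' : pi1_congruence z z' -> pi1_congruence (p ++ z) (p ++ z').
  elim=> [p' q u v uv|u|u v _ IH|v u w _ IH1 _ IH2].
  - by rewrite !(catA p); apply: cong_rel.
  - exact: cong_refl.
  - exact: cong_sym.
  - exact: cong_trans IH1 IH2.
have catl p z z' : pi1_congruence z z' -> pi1_congruence (z ++ p) (z' ++ p).
  elim=> [p' q u v uv|u|u v _ IH|v u w _ IH1 _ IH2].
  - by rewrite -!catA; apply: cong_rel.
  - exact: cong_refl.
  - exact: cong_sym.
  - exact: cong_trans IH1 IH2.
by move=> xx' yy'; apply: cong_trans (catl y _ _ xx') (catr x' _ _ yy').
Qed.

Definition gletter_inv (c : gletter) : gletter :=
  match c with
  | inl vg => vlet (tagged vg)^-1%g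
  | inr d => elet d.1 (~~ d.2)
  end.

Definition gword_inv (w : seq gletter) : seq gletter :=
  rev (map gletter_inv w).

Lemma gletter_invK : involutive gletter_inv.
Proof.
by case=> [[v g]|[e b]] /=; rewrite /vlet /elet /= ?invgK ?negbK.
Qed.

Lemma gword_invK : involutive gword_inv.
Proof. by move=> w; rewrite /gword_inv map_rev revK mapK //; exact: gletter_invK. Qed.

Lemma gletter_inv_cancel c : pi1_congruence [:: gletter_inv c; c] [::].
Proof.
have rel x y : pi1_relation x y -> pi1_congruence x y.
  by move=> xy; have := cong_rel [::] [::] xy; rewrite /= !cats0.
case: c => [[v g]|[e b]] /=.
  apply: cong_trans (rel _ _ (rel_vmul _ _)) _.
  by rewrite mulVg; apply/rel/rel_vone.
by apply: rel; have := rel_einv e (~~ b); rewrite negbK.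
Qed.

Lemma gword_inv_cancel w : pi1_congruence (gword_inv w ++ w) [::].
Proof.
elim: w => [|c w IH]; first exact: cong_refl.
rewrite /gword_inv /= rev_cons cat_rcons -/(gword_inv w).
apply: cong_trans IH.
have -> : gletter_inv c :: c :: w = [:: gletter_inv c; c] ++ w by [].
apply: pi1_congruence_cat; first exact: cong_refl.
rewrite -[X in pi1_congruence _ X]cat0s.
by apply: pi1_congruence_cat (gletter_inv_cancel c) (cong_refl w).
Qed.

Definition pi1_one : pi1 := pi1_class [::].
Definition pi1_mul (a b : pi1) : pi1 := pi1_class (repr a ++ repr b).
Definition pi1_inv (a : pi1) : pi1 := pi1_class (gword_inv (repr a)).

Lemma pi1_mulE x y : pi1_mul (pi1_class x) (pi1_class y) = pi1_class (x ++ y).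
Proof.
by apply/pi1_classP/pi1_congruence_cat; apply/pi1_classP; rewrite pi1_class_repr.
Qed.

Lemma pi1_mulA : associative pi1_mul.
Proof.
move=> a b c; rewrite -(pi1_class_repr a) -(pi1_class_repr b) -(pi1_class_repr c).
by rewrite !pi1_mulE catA.
Qed.

Lemma pi1_mul1 : left_id pi1_one pi1_mul.
Proof. by move=> a; rewrite -(pi1_class_repr a) pi1_mulE. Qed.

Lemma pi1_mulr1 : right_id pi1_one pi1_mul.
Proof. by move=> a; rewrite -(pi1_class_repr a) pi1_mulE cats0. Qed.

Lemma pi1_mulV : left_inverse pi1_one pi1_inv pi1_mul.
Proof.
move=> a; rewrite -[in X in pi1_mul _ X](pi1_class_repr a) pi1_mulE.
exact/pi1_classP/gword_inv_cancel.
Qed.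

Lemma pi1_mulrV : right_inverse pi1_one pi1_inv pi1_mul.
Proof.
move=> a; rewrite -[in X in pi1_mul X _](pi1_class_repr a) pi1_mulE.
apply/pi1_classP; rewrite -[X in X ++ _]gword_invK.
exact: gword_inv_cancel.
Qed.

HB.instance Definition _ :=
  isGroup.Build pi1 pi1_mulA pi1_mul1 pi1_mulr1 pi1_mulV pi1_mulrV.

End FundamentalGroup.

(* Main.v *)
(* Britton's lemma for the Bass-Serre tree: a word over vertex-group elements   *)
(* and edge letters is trivial in pi_1 iff, once the tree edges that make it a  *)
(* closed path are inserted, it decomposes into nested excursions d w d^-1      *)
(* whose inner closed path w has its value in the edge group of d. Hence at a   *)
(* vertex v the closed paths of value 1 are the words of the word problem of    *)
(* G_v in which some factors, spelling edge-group elements, have been replaced  *)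
(* by excursions of the same value. As the edge groups are finite, this gives   *)
(* finitely many mutually recursive languages, each obtained from multiple      *)
(* context-free ones by a finite-state transduction followed by a substitution, *)
(* and multiple context-free grammars are closed under such nested              *)
(* substitutions.                                                               *)
(* Britton's lemma comes from an action on stacks of coset representatives; all *)
(* vertex groups are embedded in their product, so that the action lives on a   *)
(* single untyped set of stacks.                                                *)
Require Import Defs.
From mathcomp Require Import all_boot classical_sets cardinality.
From HB Require Import structures.
From mathcomp Require Import all_order finmap boolp zify.

Set Implicit Arguments.
Unset Strict Implicit.
Unset Printing Implicit Defensive.

Local Open Scope classical_set_scope.
Local Open Scope nat_scope.

(** * Grammars with named variables *)

(** Fix a spanning tree and a base vertex. Conjugating each generator by tree paths turns a word
    into a closed path at the base. The fundamental group acts through such paths on stacks of coset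
    representatives, the normal forms of Britton's lemma. A path that fixes the empty stack pops
    every dart it has pushed, so it is a nesting of excursions d u d^-1 in which the value of u lies
    in the edge group ([trivial_action_loop], [based_word_loop]). Seen from its vertex, an excursion
    is just an element of a finite edge group, spelled by a fixed word over the generators of the
    vertex group. So the closed paths at v of a prescribed value come from the word problem of the
    vertex group: some factors are replaced by excursion symbols, which is a finite-state
    transduction ([transduction_mcf]), and these symbols are then expanded, their inner paths being
    of the same kind at the far end. Finiteness of the edge groups leaves finitely many such
    languages, collected in [rhs]. Each expansion fills one contiguous place, so terminals of the
    vertex grammars can be turned into nonterminals of dimension one, recursively
    ([nested_substitution_mcf]). [word_problem_expands] joins the two halves: productions preserve
    values in the group ([expands_value]), and conversely a loop is cut into blocks that the
    productions generate ([loop_blocks], [blocks_target]). *)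

Definition subst_letter (V A : Type) (y : V -> seq A) (c : V + A) : seq A :=
  match c with inl v => y v | inr a => [:: a] end.

Definition subst_word (V A : Type) (y : V -> seq A) (w : seq (V + A)) : seq A :=
  flatten [seq subst_letter y c | c <- w].

(** Linearity is stated by positions, not by counting in a concatenation: this works for any index
    type and gives each occurring variable its unique place, which [linear_pick] exploits. *)
Definition linear_template (J V A : Type) (t : J -> seq (V + A)) : Prop :=
  forall v j p j' p', onth (t j) p = Some (inl v) ->
    onth (t j') p' = Some (inl v) -> j = j' /\ p = p'.

Lemma count_mem_le1P (T : eqType) (x : T) s :
  count_mem x s <= 1 <->
  (forall p q, onth s p = Some x -> onth s q = Some x -> p = q).
Proof.
elim: s => [|y s [IH1 IH2]]; first by split=> // _ p q; rewrite onth0n.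
rewrite /=; split.
  case: eqP => [->|ne] /=.
    rewrite add1n ltnS leqn0 => /eqP c0.
    have xs : x \notin s by rewrite -has_pred1 has_count c0.
    have abs p : onth s p <> Some x by move/onthPn: xs => /(_ p)/eqP.
    by case=> [|p] [|q] //= => [_ /abs|/abs|/abs].
  rewrite add0n => /IH1 u [|p] [|q] //= => [[]//|_ []//|sp sq].
  by rewrite (u _ _ sp sq).
move=> u; case: eqP => [yx|ne] /=; last first.
  rewrite add0n; apply: IH2 => p q sp sq.
  by case: (u p.+1 q.+1 sp sq).
rewrite add1n ltnS leqn0 -[_ == 0]negbK -lt0n -has_count has_pred1.
apply/negP => /onthP [i si]; by have := u 0 i.+1; rewrite /= yx => /(_ erefl si).
Qed.

Lemma linear_templateP (V A : eqType) m (w : 'I_m -> seq (V + A)) :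
  (forall v, count_mem (inl v) (flatten [seq w j | j <- enum 'I_m]) <= 1) <->
  linear_template w.
Proof.
have sumE v : count_mem (inl v) (flatten [seq w j | j <- enum 'I_m]) =
    \sum_j count_mem (inl v) (w j).
  by rewrite count_flatten sumnE !big_map.
have pos v j p : onth (w j) p = Some (inl v) -> 0 < count_mem (inl v) (w j).
  by move=> wj; rewrite -has_count has_pred1; apply/onthP; exists p.
split=> [le1 v j p j' p' wj wj'|lin v].
  have := le1 v; rewrite sumE (bigD1 j) //= => le.
  have [jj'|ne] := eqVneq j j'; last first.
    move: le; rewrite (bigD1 j') 1?eq_sym //=; move: (\sum_(i | _) _) => c.
    move: (pos _ _ _ wj) (pos _ _ _ wj').
    by case: (count _ _) => // a; case: (count _ _) => // b; rewrite addSn addnS.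
  split=> //; subst j'; have /count_mem_le1P := leq_trans (leq_addr _ _) le.
  by apply.
rewrite sumE.
have le1 j : count_mem (inl v) (w j) <= 1.
  by apply/count_mem_le1P => p q wp wq; case: (lin _ _ _ _ _ wp wq).
have [j0 j0P|no] := pickP (fun j => inl v \in w j); last first.
  rewrite big1 // => j _; apply/eqP; rewrite -[_ == 0]negbK -lt0n -has_count.
  by rewrite has_pred1 no.
rewrite (bigD1 j0) //= big1 ?addn0 // => j ne.
apply/eqP; rewrite -[_ == 0]negbK -lt0n -has_count has_pred1.
apply: contra ne => /onthP [p wp]; move/onthP: j0P => [q wq].
by case: (lin _ _ _ _ _ wp wq) => ->.
Qed.

Section NamedGrammar.
Variable Sigma : finType.
Notation word := (seq Sigma).

(** A variable is a pair (child, coordinate) and children are indexed by any finite type. This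
    avoids arithmetic in the flattened index of [concat_tuples] when rules gain children. *)
Record named_rule (N : finType) (dim : N -> nat) := NamedRule {
  nrule_lhs : N;
  nrule_idx : finType;
  nrule_rhs : nrule_idx -> N;
  nrule_tmpl : 'I_(dim nrule_lhs) ->
    seq ({i : nrule_idx & 'I_(dim (nrule_rhs i))} + Sigma);
  nrule_linear : linear_template nrule_tmpl
}.

(* The rules are an indexed family because [named_rule], which contains a      *)
(* finType, is too large for the universe of [set].                            *)
Record named_grammar := NamedGrammar {
  ng_nonterminal : finType;
  ng_dim : ng_nonterminal -> nat;
  ng_dim_gt0 : forall A, 0 < ng_dim A;
  ng_start : ng_nonterminal;
  ng_dim_start : ng_dim ng_start = 1;
  ng_label : Type;
  ng_rule : ng_label -> named_rule ng_dim;
  ng_labels : set ng_label;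
  ng_labels_finite : finite_set ng_labels
}.

Inductive generates (G : named_grammar) :
    forall A, ('I_(@ng_dim G A) -> word) -> Prop :=
| generates_rule l
    (y : {i : nrule_idx (ng_rule l) &
          'I_(ng_dim (nrule_rhs (n:=ng_rule l) i))} -> word) :
    ng_labels l ->
    (forall i, generates (fun k : 'I_(ng_dim (nrule_rhs i)) =>
       y (Tagged (fun i => 'I_(ng_dim (nrule_rhs i))) k))) ->
    generates (fun j => subst_word y (@nrule_tmpl _ _ (ng_rule l) j)).

Definition named_language (G : named_grammar) : set word :=
  [set w | generates (fun _ : 'I_(ng_dim (ng_start G)) => w)].

Section ToNamed.
Variable H : mcfg Sigma.
Notation dim := (@dimension Sigma H).

Definition old_tmpl (r : mcfg_rule Sigma dim) :=
  sval (cid (rule_linear r)).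
Arguments old_tmpl : clear implicits.

Definition old_var (r : mcfg_rule Sigma dim)
    (k : 'I_(\sum_i dim (rule_rhs (m:=r) i))) :
    {i : 'I_(rule_arity r) & 'I_(dim (rule_rhs i))} :=
  Tagged (fun i => 'I_(dim (rule_rhs i))) (tagnat.sig2 k).

Definition map_var (V V' A : Type) (f : V -> V') (c : V + A) : V' + A :=
  match c with inl v => inl (f v) | inr a => inr a end.

Lemma old_var_inj r : injective (@old_var r).
Proof. by move=> k k'; rewrite /old_var -!tagnat.sigE12 => /tagnat.sig_inj. Qed.

Lemma linear_map_var J V V' A (f : V -> V') (t : J -> seq (V + A)) :
  injective f -> linear_template t ->
  linear_template (fun j => map (map_var f) (t j)).
Proof.
move=> fI lin v j p j' p'; rewrite !onth_map.
case E: (onth _ p) => [[u|//]|//] /= [uv].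
case E': (onth _ p') => [[u'|//]|//] /= [uv'].
have uu : u' = u by apply: fI; rewrite uv uv'.
by apply: lin E _; rewrite E' uu.
Qed.

Lemma named_of_rule_linear r :
  linear_template (fun j => map (map_var (@old_var r)) (old_tmpl r j)).
Proof.
apply: linear_map_var; first exact: old_var_inj.
by apply/linear_templateP; have [] := svalP (cid (rule_linear r)).
Qed.

Definition named_of_rule (r : mcfg_rule Sigma dim) : named_rule dim :=
  NamedRule (@named_of_rule_linear r).

Lemma subst_map_var (V V' A : Type) (f : V -> V') (y : V' -> seq A) w :
  subst_word y (map (map_var f) w) = subst_word (y \o f) w.
Proof. by rewrite /subst_word -map_comp; congr flatten; apply: eq_map => -[]. Qed.

Lemma rule_funE r u : rule_fun u =
  [ffun j => subst_word (u : 'I__ -> _) (old_tmpl r j)].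
Proof. by have [_ ->] := svalP (cid (rule_linear r)). Qed.

Definition named_of_mcfg : named_grammar :=
  NamedGrammar (@dimension_gt0 _ H) (dimension_start H)
    named_of_rule (rules_finite H).

Lemma named_of_mcfgP A (y : word ^ dim A) :
  derives y <-> generates (G:=named_of_mcfg) (A:=A) y.
Proof.
split.
  elim=> r z rr _ IH; rewrite rule_funE.
  have := @generates_rule named_of_mcfg r (fun v => z (tag v) (tagged v)) rr IH.
  congr generates; apply/funext => j; rewrite ffunE subst_map_var.
  by congr subst_word; apply/funext => k; rewrite ffunE.
suff gen B z : generates (G:=named_of_mcfg) (A:=B) z ->
    derives ([ffun k => z k] : word ^ dim B).
  by move/gen; congr derives; apply/ffunP => k; rewrite ffunE.
elim=> r {}z rr0 _ IH.
have := derives_rule rr0 IH; rewrite rule_funE; congr derives.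
apply/ffunP => k; rewrite !ffunE subst_map_var; congr subst_word.
by apply/funext => l; rewrite !ffunE.
Qed.

End ToNamed.

Section OfNamed.
Variable G : named_grammar.
Notation dim := (@ng_dim G).

Definition new_dim (r : named_rule dim) (i : 'I_#|nrule_idx r|) :=
  dim (nrule_rhs (enum_val i)).

Definition new_var (r : named_rule dim) (k : 'I_(\sum_i new_dim i)) :
    {i : nrule_idx r & 'I_(dim (nrule_rhs i))} :=
  Tagged (fun i => 'I_(dim (nrule_rhs i))) (tagnat.sig2 k).

Lemma new_var_ex r v : exists k, @new_var r k = v.
Proof.
case: v => i; rewrite -[i]enum_rankK => k.
exists (tagnat.Rank (enum_rank i) k); rewrite /new_var.
rewrite -[LHS]/((fun u : {i : 'I_#|nrule_idx r| & 'I_(new_dim i)} =>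
  Tagged (fun i => 'I_(dim (nrule_rhs i))) (tagged u)) (tagnat.sig _)).
by rewrite tagnat.rankK.
Qed.

Definition var_index r v := sval (cid (@new_var_ex r v)).

Lemma var_indexK r : cancel (@var_index r) (@new_var r).
Proof. by move=> v; apply: (svalP (cid (@new_var_ex r v))). Qed.

Definition new_tmpl r j := map (map_var (@var_index r)) (@nrule_tmpl _ _ r j).
Arguments new_tmpl : clear implicits.

Definition new_fun r (u : word ^ (\sum_i new_dim i)) :
  word ^ dim (nrule_lhs r) := [ffun j => subst_word (u : 'I__ -> _) (new_tmpl r j)].

Lemma new_fun_linear r : linear_rewriting_function (@new_fun r).
Proof.
exists (new_tmpl r); split; last by [].
apply/linear_templateP/linear_map_var; first exact: can_inj (@var_indexK r).
exact: nrule_linear.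
Qed.

Definition rule_of_named (r : named_rule dim) : mcfg_rule Sigma dim :=
  @MCFGRule _ _ dim (nrule_lhs r) #|nrule_idx r|
    (fun i => nrule_rhs (enum_val i)) _ (@new_fun_linear r).

Definition mcfg_of_named : mcfg Sigma :=
  MCFG (@ng_dim_gt0 G) (ng_dim_start G)
    (finite_image (rule_of_named \o @ng_rule G) (@ng_labels_finite G)).

Lemma mcfg_of_namedP A (y : 'I_(dim A) -> word) :
  derives (H:=mcfg_of_named) (A:=A) [ffun k => y k] <-> generates y.
Proof.
split; last first.
  elim=> l z rl _ IH; pose r := ng_rule l.
  have := @derives_rule _ mcfg_of_named (rule_of_named r)
    (fun i => [ffun k => z (Tagged (fun i => 'I_(dim (nrule_rhs i))) k)]).
  move=> /(_ (ex_intro2 _ _ l rl erefl) (fun i => IH (enum_val i))).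
  congr derives; apply/ffunP => j; rewrite !ffunE subst_map_var.
  congr subst_word; apply/funext => v; rewrite /= !ffunE.
  by rewrite -[in RHS](var_indexK v).
suff gen B z : derives (H:=mcfg_of_named) (A:=B) z ->
    generates (z : 'I_(dim B) -> word).
  by move/gen; congr generates; apply/funext => k; rewrite ffunE.
elim=> r {}z [l rl Er]; move: z; case: _ / Er => z _ /= IH.
pose r0 := ng_rule l.
(* The premises are indexed by ordinals; [z'] carries them back to [nrule_idx] along [enum_rankK],
   and [z'E] removes the cast. *)
pose T i := 'I_(dim (@nrule_rhs _ _ r0 i)) -> word.
pose z' i : T i := ecast i (T i) (enum_rankK i) (z (enum_rank i)).
have z'E i : z' (enum_val i) = z i.
  rewrite /z'; move: (enum_rankK _) => e; have := enum_valK i; move: e.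
  by move: (enum_rank _) => j e ji; subst j; rewrite eq_axiomK.
have := @generates_rule G l (fun v => z' (tag v) (tagged v)) rl.
have h i : generates (z' i).
  by rewrite -(enum_rankK i) z'E; exact: IH.
move=> /(_ h); congr generates; apply/funext => j; rewrite ffunE subst_map_var.
congr subst_word; apply/funext => v; rewrite -[in LHS](var_indexK v) /= !ffunE.
by rewrite z'E.
Qed.

End OfNamed.

Lemma multiple_context_freeP (L : set word) :
  multiple_context_free L <-> exists G, L = named_language G.
Proof.
split=> [[H ->]|[G ->]].
  exists (named_of_mcfg H); apply/predeqP => w.
  rewrite /mcfg_language /named_language /= named_of_mcfgP.
  by split; congr generates; apply/funext => k; rewrite ffunE.
exists (mcfg_of_named G); apply/predeqP => w.
rewrite /mcfg_language /named_language /= -mcfg_of_namedP.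
by split; congr derives; apply/ffunP => k; rewrite !ffunE.
Qed.

End NamedGrammar.

(** * Trimmed grammars *)

Lemma subst_word_cons V A (y : V -> seq A) c w :
  subst_word y (c :: w) = subst_letter y c ++ subst_word y w.
Proof. by []. Qed.

Lemma eq_subst_word (V : eqType) A (y z : V -> seq A) (w : seq (V + A)) :
  (forall p v, onth w p = Some (inl v) -> y v = z v) ->
  subst_word y w = subst_word z w.
Proof.
elim: w => // c w IH eqyz; rewrite !subst_word_cons IH.
  by case: c eqyz => //= v /(_ 0 v erefl) ->.
by move=> p v; apply: (eqyz p.+1 v).
Qed.

Section FiniteLanguage.
Variables (Sigma : finType) (s : seq (seq Sigma)).

Lemma constant_rule_linear (w : seq Sigma) :
  linear_template (fun _ : 'I_1 =>
    map inr w : seq ({i : void & 'I_1} + Sigma)).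
Proof. by move=> v j p j' p'; rewrite onth_map; case: (onth w p). Qed.

Definition finite_grammar : named_grammar Sigma :=
  @NamedGrammar Sigma unit (fun=> 1) (fun=> isT) tt erefl (seq Sigma)
    (fun w => @NamedRule Sigma unit (fun=> 1) tt void (fun=> tt) (fun=> map inr w)
       (@constant_rule_linear w))
    [set` s] (finite_seq s).

Lemma finite_language_mcf : multiple_context_free [set w | w \in s].
Proof.
apply/multiple_context_freeP; exists finite_grammar.
have cst (y : {i : void & 'I_1} -> seq Sigma) w : subst_word y (map inr w) = w.
  by elim: w => //= a w IH; rewrite subst_word_cons IH.
rewrite predeqE => w; rewrite /named_language /=; split=> [ws|].
  have := @generates_rule Sigma finite_grammar w (fun v => [::]) ws.
  move=> /(_ (fun i => match i with end)).
  by congr generates; apply/funext => j; apply: cst.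
suff gen A z : generates (G:=finite_grammar) (A:=A) z -> z ord0 \in s.
  by move/gen.
by elim=> {}w y ws _ _; rewrite (cst y).
Qed.

End FiniteLanguage.

Definition rule_var Sigma (G : named_grammar Sigma) (l : ng_label G) : finType :=
  {i : nrule_idx (ng_rule l) & 'I_(ng_dim (nrule_rhs i))}.

Definition rule_tmpl Sigma (G : named_grammar Sigma) (l : ng_label G)
    (j : 'I_(ng_dim (nrule_lhs (ng_rule l)))) : seq (rule_var l + Sigma) :=
  @nrule_tmpl _ _ _ (ng_rule l) j.

(* Linear rules may erase variables. What an erased variable holds may become  *)
(* underivable after a substitution, so we arrange that it is always empty.    *)
Definition trimmed Sigma (G : named_grammar Sigma) : Prop :=
  forall l (y : rule_var l -> seq Sigma),
    ng_labels (n:=G) l ->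
    (forall i, generates (fun k : 'I_(ng_dim (nrule_rhs i)) =>
       y (Tagged (fun i => 'I_(ng_dim (nrule_rhs i))) k))) ->
    forall v, (exists j p, onth (rule_tmpl (l:=l) j) p = Some (inl v)) \/
      y v = [::].

Section Trim.
Variables (Sigma : finType) (G : named_grammar Sigma).

(** A nonterminal is paired with the set of its coordinates that will survive in the final word; all
    the others are emptied. *)
Definition trim_nonterminal : finType :=
  {A : ng_nonterminal G & {ffun 'I_(ng_dim A) -> bool}}.
Definition trim_nt A (f : {ffun 'I_(ng_dim A) -> bool}) : trim_nonterminal :=
  Tagged (fun A => {ffun 'I_(ng_dim A) -> bool}) f.
Definition trim_dim (A : trim_nonterminal) := ng_dim (tag A).

Definition trim_label := {l : ng_label G & {ffun 'I_(ng_dim (nrule_lhs (ng_rule l))) -> bool}}.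

Definition kept (x : trim_label)
  (v : rule_var (tag x)) :=
  [exists j, tagged x j && (inl v \in rule_tmpl (l:=tag x) j)].

Definition trim_tmpl (x : trim_label) (j : 'I_(ng_dim (nrule_lhs (ng_rule (tag x))))) :=
  if tagged x j then rule_tmpl (l:=tag x) j else [::].

Lemma trim_linear x : linear_template (@trim_tmpl x).
Proof.
move=> v j p j' p'; rewrite /trim_tmpl.
do 2![case: ifP => _; last by rewrite onth0n].
exact: nrule_linear.
Qed.

Definition trim_rule (x : trim_label) : named_rule Sigma trim_dim :=
  @NamedRule Sigma trim_nonterminal trim_dim (trim_nt (tagged x))
    (nrule_idx (ng_rule (tag x)))
    (fun i => trim_nt
       [ffun k => kept (x:=x) (Tagged (fun i => 'I_(ng_dim (nrule_rhs i))) k)])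
    (@trim_tmpl x) (@trim_linear x).

Lemma trim_labels_finite :
  finite_set [set x : trim_label | ng_labels (tag x)].
Proof.
apply: (@sub_finite_set _ _ (\bigcup_(l in @ng_labels _ G)
  range (fun f => Tagged (fun l => {ffun 'I_(ng_dim (nrule_lhs (ng_rule l))) -> bool}) f
    : trim_label))).
  by case=> l f /= ll; exists l => //; exists f.
by apply: bigcup_finite (@ng_labels_finite _ G) _ => l _; apply: finite_image.
Qed.

Definition trim_grammar : named_grammar Sigma :=
  @NamedGrammar Sigma trim_nonterminal trim_dim (fun A => ng_dim_gt0 (tag A))
    (trim_nt [ffun _ : 'I_(ng_dim (ng_start G)) => true]) (ng_dim_start G)
    trim_label trim_rule _ trim_labels_finite.

Definition mask n (f : 'I_n -> bool) (x : 'I_n -> seq Sigma) j :=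
  if f j then x j else [::].

Lemma subst_trim (x : trim_label) y y' j : tagged x j ->
  (forall v, kept (x:=x) v -> y v = y' v) ->
  subst_word y (rule_tmpl (l:=tag x) j) =
  subst_word y' (rule_tmpl (l:=tag x) j).
Proof.
move=> xj eqy; apply: eq_subst_word => p v tp; apply: eqy; apply/existsP.
by exists j; rewrite xj; apply/onthP; exists p.
Qed.

Lemma trim_sound (A : trim_nonterminal) z :
  generates (G:=trim_grammar) (A:=A) z ->
  exists2 x : 'I_(ng_dim (tag A)) -> seq Sigma,
    generates x & z = mask (tagged A) x.
Proof.
elim=> x y xl _ IH.
pose Y i := s2val (cid2 (IH i)).
have YP i : generates (Y i) /\ _ := conj (s2valP (cid2 (IH i))) (s2valP' (cid2 (IH i))).
pose y' (v : rule_var (tag x)) := Y (tag v) (tagged v).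
exists (fun j => subst_word y' (rule_tmpl (l:=tag x) j)).
  by apply: generates_rule => // i; have [] := YP i.
apply/funext => j; rewrite /mask /= /trim_tmpl; case: ifP => // xj.
apply: subst_trim xj _ => -[i k] kv; have [_ /(congr1 (@^~ k))] := YP i.
by rewrite /mask /= ffunE kv.
Qed.

(** The mask is quantified inside the induction, because masks are imposed from the root of a
    derivation downwards. *)
Lemma trim_complete A (x : 'I_(ng_dim A) -> seq Sigma) : generates x ->
  forall f : {ffun 'I_(ng_dim A) -> bool},
    generates (G:=trim_grammar) (A:=trim_nt f) (mask f x).
Proof.
elim=> l y ll _ IH f; pose x0 : trim_label := Tagged _ f.
have := @generates_rule Sigma trim_grammar x0
  (fun v => if kept (x:=x0) v then y v else [::]) ll.
have h i : generates (G:=trim_grammar) (A:=@nrule_rhs _ _ _ (trim_rule x0) i)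
   (fun k => if kept (x:=x0) (Tagged _ k) then y (Tagged _ k) else [::]).
  have := IH i [ffun k => kept (x:=x0) (Tagged (fun i => 'I_(ng_dim (nrule_rhs i))) k)].
  by congr generates; apply/funext => k; rewrite /mask ffunE.
move=> /(_ h); congr generates; apply/funext => j.
rewrite /mask /= /trim_tmpl /=; case: ifP => // fj.
by apply: (subst_trim (x:=x0)) => // v ->.
Qed.

(** A variable that is not [kept] sits in a masked coordinate of its child, so [trim_sound] forces
    it to be empty. *)
Lemma trim_grammar_trimmed : trimmed trim_grammar.
Proof.
move=> x y xl gen [i k]; have [X _ /(congr1 (@^~ k))] := trim_sound (gen i).
rewrite /mask /= ffunE; case: ifP => [|_ ->]; last by right.
move=> /existsP [j /andP [xj /onthP [p tp]]] _; left; exists j, p.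
by rewrite /rule_tmpl /= /trim_tmpl xj.
Qed.

Lemma trim_language : named_language trim_grammar = named_language G.
Proof.
rewrite predeqE => w; rewrite /named_language /=; split.
  move=> /trim_sound [x xgen /= ->]; congr generates: xgen.
  by apply/funext => j; rewrite /mask ffunE.
move=> /trim_complete /(_ [ffun=> true]).
by congr generates; apply/funext => j; rewrite /mask ffunE.
Qed.

End Trim.

Lemma multiple_context_free_trimmedP (Sigma : finType) (L : set (seq Sigma)) :
  multiple_context_free L <-> exists2 G, trimmed G & L = named_language G.
Proof.
rewrite multiple_context_freeP; split=> [[G ->]|[G _ ->]]; last by exists G.
by exists (trim_grammar G); [exact: trim_grammar_trimmed|rewrite trim_language].
Qed.

(** * Finite-state transductions *)

(** Linearity turns data attached to template positions into data attached to variables: an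
    occurring variable takes the datum of its only occurrence, an erased one the default. *)
Lemma linear_pick (J V A B : Type) (t : J -> seq (V + A)) (b : J -> seq B)
    (dflt : V -> B) : linear_template t ->
  (forall j, size (b j) = size (t j)) ->
  exists g : V -> B,
    (forall j p v c, onth (t j) p = Some (inl v) -> onth (b j) p = Some c ->
       g v = c) /\
    (forall v, (exists j p, onth (t j) p = Some (inl v) /\
                            onth (b j) p = Some (g v)) \/
               (forall j p, onth (t j) p <> Some (inl v)) /\ g v = dflt v).
Proof.
move=> lin sz.
pose P v c := (exists j p, onth (t j) p = Some (inl v) /\ onth (b j) p = Some c) \/
   (forall j p, onth (t j) p <> Some (inl v)) /\ c = dflt v.
have [g gP] : {g : V -> B & forall v, P v (g v)}.
  suff h v : {c | P v c} by exists (fun v => sval (h v)) => v; apply: svalP.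
  apply: cid; have [[j [p tp]]|no] := pselect (exists j p, onth (t j) p = Some (inl v)).
    have : onth (b j) p by rewrite onthTE sz -onthTE tp.
    by case E: (onth (b j) p) => [c|//] _; exists c; left; exists j, p.
  by exists (dflt v); right; split=> // j p tp; apply: no; exists j, p.
exists g; split=> // j p v c tp bp.
have [[j' [p' [tp' bp']]]|[no _]] := gP v; last by case: (no j p).
have [jj pp] := lin _ _ _ _ _ tp tp'; subst j' p'.
by move: bp'; rewrite bp => -[].
Qed.

Section Transduction.
Variables (Sigma Gamma Q : finType).
Variable delta : Q -> Sigma -> Gamma -> Q -> Prop.

(** Runs are length-preserving, which bounds the output templates. Deletion is obtained later
    through an output symbol that expands to the empty word. *)
Inductive run : Q -> seq Sigma -> seq Gamma -> Q -> Prop :=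
| run_nil p : run p [::] [::] p
| run_cons p q r a b x z :
    delta p a b q -> run q x z r -> run p (a :: x) (b :: z) r.

Lemma run_nilI p z q : run p [::] z q -> z = [::] /\ p = q.
Proof. by move=> h; inversion h. Qed.

Lemma run_consI p a x z r : run p (a :: x) z r ->
  exists b z' q, [/\ z = b :: z', delta p a b q & run q x z' r].
Proof. by move=> h; inversion h as [|? q ? ? b ? z']; subst; exists b, z', q. Qed.

Lemma run_cat p q r x z x' z' :
  run p x z q -> run q x' z' r -> run p (x ++ x') (z ++ z') r.
Proof.
by elim=> // {}p q0 q1 a b {}x {}z h _ IH /IH; apply: run_cons.
Qed.

Lemma run_catI p r x x' z : run p (x ++ x') z r ->
  exists q z1 z2, [/\ z = z1 ++ z2, run p x z1 q & run q x' z2 r].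
Proof.
elim: x p z => [|a x IH] p z /=.
  by exists p, [::], z; split=> //; apply: run_nil.
move=> /run_consI [b [z' [q [-> pq /IH [q' [z1 [z2 [-> r1 r2]]]]]]]].
by exists q', (b :: z1), z2; split=> //; apply: run_cons r1.
Qed.

(** A run in which the states before and after the future content of each variable have been guessed
    by [sv]. *)
Inductive template_run (V : Type) (sv : V -> Q * Q) :
    Q -> seq (V + Sigma) -> seq (V + Gamma) -> Q -> Prop :=
| template_run_nil p : template_run sv p [::] [::] p
| template_run_var v t t' r : template_run sv (sv v).2 t t' r ->
    template_run sv (sv v).1 (inl v :: t) (inl v :: t') r
| template_run_letter p q a b t t' r : delta p a b q ->
    template_run sv q t t' r -> template_run sv p (inr a :: t) (inr b :: t') r.

Lemma template_run_onth V (sv : V -> Q * Q) p t t' r : template_run sv p t t' r ->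
  size t' = size t /\
  forall k v, onth t' k = Some (inl v) <-> onth t k = Some (inl v).
Proof.
elim=> {p t t' r} [p|v t t' r _ [sz IH]|p q a b t t' r _ _ [sz IH]] /=.
  by split=> // k v; rewrite !onth0n.
  by rewrite sz; split=> // -[|k] u /=; [split=> -[->]|apply: IH].
by rewrite sz; split=> // -[|k] u /=; [split|apply: IH].
Qed.

Lemma template_run_subst V (sv : V -> Q * Q) p t t' r x z :
  template_run sv p t t' r -> (forall v, run (sv v).1 (x v) (z v) (sv v).2) ->
  run p (subst_word x t) (subst_word z t') r.
Proof.
move=> + h; elim=> {p t t' r} [p|v t t' r _ IH|p q a b t t' r pq _ IH].
- exact: run_nil.
- by rewrite !subst_word_cons; apply: run_cat IH; apply: h.
- by apply: run_cons IH.
Qed.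

(** Cuts a run on a substituted template at the template letters, recording for each its entry
    state, exit state and output. *)
Inductive pieces (V : Type) (x : V -> seq Sigma) :
    Q -> seq (V + Sigma) -> seq (Q * Q * seq Gamma) -> Q -> Prop :=
| pieces_nil p : pieces x p [::] [::] p
| pieces_cons p q r c t z b : run p (subst_letter x c) z q ->
    pieces x q t b r -> pieces x p (c :: t) ((p, q, z) :: b) r.

Lemma pieces_ex V (x : V -> seq Sigma) p t z r : run p (subst_word x t) z r ->
  exists b, pieces x p t b r /\ z = flatten [seq c.2 | c <- b].
Proof.
elim: t p z => [|c t IH] p z.
  by move=> /run_nilI [-> ->]; exists [::]; split=> //; apply: pieces_nil.
rewrite subst_word_cons => /run_catI [q [z1 [z2 [-> r1 /IH [b [pb ->]]]]]].
by exists ((p, q, z1) :: b); split=> //; apply: pieces_cons.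
Qed.

Fixpoint pieces_out V (t : seq (V + Sigma)) (b : seq (Q * Q * seq Gamma)) :
    seq (V + Gamma) :=
  match t, b with
  | inl v :: t, _ :: b => inl v :: pieces_out t b
  | inr _ :: t, c :: b => map inr c.2 ++ pieces_out t b
  | _, _ => [::]
  end.

Lemma pieces_onth V (x : V -> seq Sigma) p t b r : pieces x p t b r ->
  size b = size t /\ forall k v c, onth t k = Some (inl v) ->
    onth b k = Some c -> run c.1.1 (x v) c.2 c.1.2.
Proof.
elim=> {p t b r} [//|p q r c t z b pq _ [sz IH]] /=; first by split=> // k v c; rewrite onth0n.
rewrite sz; split=> // -[|k] v d /=; last exact: IH.
by move=> [cv] [<-] /=; rewrite cv in pq.
Qed.

Lemma pieces_run V (x : V -> seq Sigma) (g : V -> Q * Q * seq Gamma) p t b r :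
  pieces x p t b r ->
  (forall k v c, onth t k = Some (inl v) -> onth b k = Some c -> g v = c) ->
  template_run (fun v => (g v).1) p t (pieces_out t b) r /\
  subst_word (fun v => (g v).2) (pieces_out t b) = flatten [seq c.2 | c <- b].
Proof.
elim=> {p t b r} [p|p q r c t z b pq _ IH] gP; first by split=> //; apply: template_run_nil.
have [IH1 IH2] := IH (fun k v c => gP k.+1 v c).
case: c pq gP => [v|a] /= pq gP.
  have := gP 0 v _ erefl erefl => gv; rewrite subst_word_cons IH2 /= gv; split=> //.
  have -> : p = (g v).1.1 by rewrite gv.
  by apply: (template_run_var (sv:=fun v => (g v).1)); rewrite gv.
have [e [z' [q' [ez d /run_nilI [ez' eq']]]]] := run_consI pq; subst z z' q'.
rewrite /= subst_word_cons IH2; split=> //; exact: template_run_letter IH1.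
Qed.

Section TransductionGrammar.
Variables (G : named_grammar Sigma) (p0 q0 : Q).

(** The product construction: each coordinate carries the two states between which its output is
    produced. *)
Definition trans_nonterminal : finType :=
  {A : ng_nonterminal G & {ffun 'I_(ng_dim A) -> Q * Q}}.
Definition trans_nt A (f : {ffun 'I_(ng_dim A) -> Q * Q}) : trans_nonterminal :=
  Tagged (fun A => {ffun 'I_(ng_dim A) -> Q * Q}) f.
Definition trans_dim (A : trans_nonterminal) := ng_dim (tag A).

Definition max_tmpl (l : ng_label G) :=
  \max_(j < ng_dim (nrule_lhs (ng_rule l))) size (rule_tmpl j).

(** A finite type of guesses: states for the variables, states for the coordinates, and output
    templates, which are no longer than the input templates. *)
Definition trans_data (l : ng_label G) : finType :=
  ({ffun rule_var l -> Q * Q} *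
   {ffun 'I_(ng_dim (nrule_lhs (ng_rule l))) -> Q * Q} *
   {ffun 'I_(ng_dim (nrule_lhs (ng_rule l))) ->
     (max_tmpl l).-bseq (rule_var l + Gamma)})%type.

Definition trans_ok l (d : trans_data l) : Prop :=
  forall j, template_run d.1.1 (d.1.2 j).1 (rule_tmpl j) (d.2 j) (d.1.2 j).2.

Definition trans_label : Type :=
  {l : ng_label G & {d : trans_data l | `[< trans_ok d >]}}.

Lemma trans_linear (x : trans_label) :
  linear_template (fun j => (val (tagged x)).2 j : seq _).
Proof.
case: x => l [d /= /asboolP ok] v j p j' p' /=.
have [_ E] := template_run_onth (ok j); have [_ E'] := template_run_onth (ok j').
by move=> /E tp /E'; apply: (nrule_linear tp).
Qed.

Definition trans_rule (x : trans_label) : named_rule Gamma trans_dim :=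
  @NamedRule Gamma trans_nonterminal trans_dim
    (trans_nt (val (tagged x)).1.2)
    (nrule_idx (ng_rule (tag x)))
    (fun i => trans_nt [ffun k => (val (tagged x)).1.1
       (Tagged (fun i => 'I_(ng_dim (nrule_rhs i))) k)])
    (fun j => (val (tagged x)).2 j) (@trans_linear x).

Lemma trans_labels_finite : finite_set [set x : trans_label | ng_labels (tag x)].
Proof.
apply: (@sub_finite_set _ _ (\bigcup_(l in @ng_labels _ G)
  range (fun f => Tagged (fun l => {d : trans_data l | `[< trans_ok d >]}) f
    : trans_label))).
  by case=> l f /= ll; exists l => //; exists f.
by apply: bigcup_finite (@ng_labels_finite _ G) _ => l _; apply: finite_image.
Qed.

Definition trans_grammar : named_grammar Gamma :=
  @NamedGrammar Gamma trans_nonterminal trans_dim (fun A => ng_dim_gt0 (tag A))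
    (trans_nt [ffun _ : 'I_(ng_dim (ng_start G)) => (p0, q0)]) (ng_dim_start G)
    trans_label trans_rule _ trans_labels_finite.

Lemma trans_sound (A : trans_nonterminal) z :
  generates (G:=trans_grammar) (A:=A) z ->
  exists2 x : 'I_(ng_dim (tag A)) -> seq Sigma, generates x &
    forall j, run (tagged A j).1 (x j) (z j) (tagged A j).2.
Proof.
elim=> -[l [d okd]] y xl _ IH; have /asboolP ok := okd.
pose Y i := s2val (cid2 (IH i)).
have Ygen i : generates (Y i) := s2valP (cid2 (IH i)).
have Yrun i := s2valP' (cid2 (IH i)).
pose y' (v : rule_var l) := Y (tag v) (tagged v).
exists (fun j => subst_word y' (rule_tmpl j)).
  by apply: generates_rule => // i; apply: Ygen.
move=> j /=; apply: (template_run_subst (ok j)) => -[i k].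
by have := Yrun i k; rewrite /= ffunE.
Qed.

Lemma trans_complete A (x : 'I_(ng_dim A) -> seq Sigma) : trimmed G ->
  generates x ->
  forall (f : {ffun 'I_(ng_dim A) -> Q * Q}) z,
    (forall j, run (f j).1 (x j) (z j) (f j).2) ->
    generates (G:=trans_grammar) (A:=trans_nt f) z.
Proof.
move=> trim; elim=> l y ll gen IH f z zrun.
pose B j := sval (cid (pieces_ex (zrun j))).
have Bp j : pieces y (f j).1 (rule_tmpl j) (B j) (f j).2.
  by have [] := svalP (cid (pieces_ex (zrun j))).
have zE j : z j = flatten [seq c.2 | c <- B j].
  by have [] := svalP (cid (pieces_ex (zrun j))).
have sz j : size (B j) = size (rule_tmpl j) by have [] := pieces_onth (Bp j).
have [g [gP gdef]] := linear_pick (fun v => (p0, p0, [::])) (@nrule_linear _ _ _ (ng_rule l)) sz.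
(* A variable that occurs inherits the run of its occurrence. One that does not is empty, as [G] is
   trimmed, and the default [(p0, p0, [::])] is the empty run; without trimming its content might
   admit no run at all. *)
have grun v : run (g v).1.1 (y v) (g v).2 (g v).1.2.
  have [[j [k [tk bk]]]|[no ->]] := gdef v.
    by have [_] := pieces_onth (Bp j); apply; [exact: tk|exact: bk].
  have [[j [k tk]]|->] := trim l y ll gen v; last exact: run_nil.
  by case: (no j k).
pose out j := pieces_out (rule_tmpl j) (B j).
have out_run j : template_run (fun v => (g v).1) (f j).1 (rule_tmpl j) (out j) (f j).2.
  by have [] := pieces_run (Bp j) (gP j).
have outE j : subst_word (fun v => (g v).2) (out j) = z j.
  by have [_ ->] := pieces_run (Bp j) (gP j).
have out_sz j : size (out j) <= max_tmpl l.
  have [-> _] := template_run_onth (out_run j).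
  exact: (leq_bigmax (F:=fun j => size (rule_tmpl (l:=l) j))).
pose d : trans_data l := ([ffun v => (g v).1], f, [ffun j => Bseq (out_sz j)]).
have okd : `[< trans_ok d >].
  apply/asboolP => j /=; rewrite ffunE /=.
  rewrite (_ : [ffun v => (g v).1] = (fun v => (g v).1) :> (_ -> _)); first exact: out_run.
  by apply/funext => v; rewrite ffunE.
pose X : trans_label := Tagged (fun l => {d : trans_data l | `[< trans_ok d >]}) (exist _ d okd).
have := @generates_rule Gamma trans_grammar X (fun v => (g v).2) ll.
have h i : generates (G:=trans_grammar) (A:=@nrule_rhs _ _ _ (trans_rule X) i)
   (fun k => (g (Tagged _ k)).2).
  by apply: IH => k; rewrite !ffunE; apply: grun.
move=> /(_ h); congr generates; apply/funext => j.
by rewrite -outE /= ffunE.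
Qed.

End TransductionGrammar.

Lemma transduction_mcf (L : set (seq Sigma)) p q :
  multiple_context_free L ->
  multiple_context_free [set z | exists2 x, L x & run p x z q].
Proof.
move=> /multiple_context_free_trimmedP [G trim ->].
apply/multiple_context_freeP; exists (trans_grammar G p q).
rewrite predeqE => z; rewrite /named_language /=; split.
  by move=> [x xgen r]; apply: trans_complete xgen _ _ _ => // j; rewrite ffunE.
move=> /trans_sound [x xgen xrun].
have j0 : 'I_(ng_dim (ng_start G)) by rewrite ng_dim_start; exact: ord0.
exists (x j0); last by have := xrun j0; rewrite ffunE.
congr generates: xgen; apply/funext => j; congr x; apply: val_inj.
have lt1 (i : 'I_(ng_dim (ng_start G))) : val i = 0.
  by case: i => i /=; rewrite ng_dim_start; case: i.
by rewrite !lt1.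
Qed.

End Transduction.

(** * Nested substitution *)

Section NestedSubstitution.
Variables (K Delta : finType) (R : K -> set (seq (K + Delta))).

(** Derivations in a context-free grammar whose right-hand sides for [k] form an arbitrary, possibly
    infinite, language [R k]. *)
Inductive expands : seq (K + Delta) -> seq Delta -> Prop :=
| expands_nil : expands [::] [::]
| expands_letter a x w : expands x w -> expands (inr a :: x) (a :: w)
| expands_rule k y x w w' : R k y -> expands y w -> expands x w' ->
    expands (inl k :: x) (w ++ w').

Lemma expands_cat x y w z : expands x w -> expands y z -> expands (x ++ y) (w ++ z).
Proof.
move=> xw yz; elim: xw => {x w} [|a x w _ IH|k y0 x w0 w' ky ex _ _ IH] //=.
  exact: expands_letter.
by rewrite -catA; apply: (expands_rule ky ex).
Qed.

Lemma expands_seq n (X : 'I_n -> seq (K + Delta)) (Z : 'I_n -> seq Delta) s :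
  (forall i, expands (X i) (Z i)) ->
  expands (flatten (map X s)) (flatten (map Z s)).
Proof.
move=> XZ; elim: s => [|i s IH] /=; first exact: expands_nil.
exact: expands_cat.
Qed.

Section SubstitutionGrammar.
Variables (G : K -> named_grammar (K + Delta)%type) (k0 : K).
Hypothesis GE : forall k, R k = named_language (G k).
Hypothesis Gtrim : forall k, trimmed (G k).

(* The nonterminal [inr (Some c)] yields the expansions of the letter c. The   *)
(* nonterminal [inr None], yielding only the empty word, is attached to those  *)
(* template positions that hold a variable.                                    *)
Definition sub_nonterminal : finType :=
  ({k : K & ng_nonterminal (G k)} + option (K + Delta))%type.

Definition sub_nt k (A : ng_nonterminal (G k)) : sub_nonterminal :=
  inl (Tagged (fun k => ng_nonterminal (G k)) A).

Definition sub_dim (A : sub_nonterminal) : nat :=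
  match A with inl kA => ng_dim (tagged kA) | inr _ => 1 end.

Lemma sub_dim_gt0 A : 0 < sub_dim A.
Proof. by case: A => [[k A]|] //=; apply: ng_dim_gt0. Qed.

Definition sub_label : Type :=
  ({k : K & ng_label (G k)} + option (K + Delta))%type.

Section CopiedRule.
Variables (k : K) (l : ng_label (G k)).

Let pos : finType := {j : 'I_(ng_dim (nrule_lhs (ng_rule l))) &
                      'I_(size (rule_tmpl j))}.

Definition letter_at (jp : pos) := tnth (in_tuple (rule_tmpl (tag jp))) (tagged jp).

(** One extra child per template position lets every occurrence of a letter be expanded
    independently while the rule stays linear. *)
Definition copied_idx : finType := (nrule_idx (ng_rule l) + pos)%type.

Definition copied_rhs (i : copied_idx) : sub_nonterminal :=
  match i with
  | inl i => sub_nt (nrule_rhs i)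
  | inr jp => inr (if letter_at jp is inr c then Some c else None)
  end.

Definition copied_var (v : rule_var l) : {i : copied_idx & 'I_(sub_dim (copied_rhs i))} :=
  @Tagged copied_idx (inl (tag v)) (fun i => 'I_(sub_dim (copied_rhs i))) (tagged v).

Definition fresh_var (jp : pos) : {i : copied_idx & 'I_(sub_dim (copied_rhs i))} :=
  @Tagged copied_idx (inr jp) (fun i => 'I_(sub_dim (copied_rhs i))) ord0.

Definition copied_letter (jp : pos) : {i : copied_idx & 'I_(sub_dim (copied_rhs i))} :=
  match letter_at jp with inl v => copied_var v | inr _ => fresh_var jp end.

Definition copied_tmpl (j : 'I_(ng_dim (nrule_lhs (ng_rule l)))) :
    seq ({i : copied_idx & 'I_(sub_dim (copied_rhs i))} + Delta) :=
  [seq inl (copied_letter (Tagged _ p)) | p <- enum 'I_(size (rule_tmpl j))].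

Lemma copied_var_inj : injective copied_var.
Proof.
pose back (u : {i : copied_idx & 'I_(sub_dim (copied_rhs i))}) : option (rule_var l) :=
  match u with
  | existT (inl i) k => Some (Tagged (fun i => 'I_(ng_dim (nrule_rhs i))) k)
  | _ => None
  end.
have backK v : back (copied_var v) = Some v by case: v.
by move=> v v' /(congr1 back); rewrite !backK => -[].
Qed.

Lemma onth_letter_at j (p : 'I_(size (rule_tmpl j))) :
  onth (rule_tmpl j) p = Some (letter_at (Tagged _ p)).
Proof.
rewrite /letter_at /= (tnth_nth (letter_at (Tagged _ p))) /=.
by rewrite onthE (nth_map (letter_at (Tagged _ p))).
Qed.

(** Two positions never share a variable: old variables by linearity of the rule, fresh ones because
    they are named by their position. *)
Lemma copied_letter_inj j p j' p' :
  copied_letter (@Tagged _ j _ p) = copied_letter (@Tagged _ j' _ p') ->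
  j = j' /\ val p = val p'.
Proof.
have fresh jp jp' : fresh_var jp = fresh_var jp' -> jp = jp'.
  by move=> /(congr1 tag) [].
rewrite /copied_letter.
case E: (letter_at _) => [v|a]; case E': (letter_at _) => [v'|a'] //.
- move=> /copied_var_inj vv'; subst v'.
  have := @nrule_linear _ _ _ (ng_rule l) v j p j' p'.
  by apply; rewrite [LHS]onth_letter_at ?E ?E'.
- by move=> /fresh jj'; have jj : j = j' := congr1 tag jj'; subst j';
    move/eqP: jj'; rewrite eq_Tagged /= => /eqP ->.
Qed.

Lemma copied_linear : linear_template copied_tmpl.
Proof.
move=> v j p j' p'.
have onth_enum n q i : onth (enum 'I_n) q = Some i -> q = val i.
  move=> qi; have qn : q < n by rewrite -[n in _ < n]size_enum_ord -onthTE qi.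
  by rewrite -(@onth_nth _ i _ _ _ qi); apply/esym/nth_enum_ord.
rewrite /copied_tmpl onth_map; case E: (onth _ p) => [q|//] [<-].
rewrite onth_map.
case E': (onth _ p') => [q'|//] [eq].
have [jj qq] := copied_letter_inj eq.
by rewrite (onth_enum _ _ _ E) (onth_enum _ _ _ E') qq.
Qed.

Definition copied_rule : named_rule Delta sub_dim :=
  @NamedRule Delta sub_nonterminal sub_dim (sub_nt (nrule_lhs (ng_rule l)))
    copied_idx copied_rhs copied_tmpl copied_linear.

Lemma subst_rule_tmpl (y : rule_var l -> seq (K + Delta)) j :
  subst_word y (rule_tmpl j) =
  flatten [seq subst_letter y (letter_at (Tagged _ p)) | p <- enum 'I_(size (rule_tmpl j))].
Proof.
rewrite /subst_word -{1}[rule_tmpl j](map_tnth_enum (in_tuple (rule_tmpl j))).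
by rewrite -map_comp.
Qed.

Lemma subst_copied_tmpl (y : {i : copied_idx & 'I_(sub_dim (copied_rhs i))} -> seq Delta) j :
  subst_word y (copied_tmpl j) =
  flatten [seq y (copied_letter (Tagged _ p)) | p <- enum 'I_(size (rule_tmpl j))].
Proof. by rewrite /subst_word -map_comp. Qed.

End CopiedRule.

Lemma constant_linear (w : seq Delta) : linear_template (fun _ : 'I_1 =>
  map inr w : seq ({i : void & 'I_(sub_dim (of_void _ i))} + Delta)).
Proof. by move=> v j p j' p'; rewrite onth_map; case: (onth w p). Qed.

Definition constant_rule c (w : seq Delta) : named_rule Delta sub_dim :=
  @NamedRule Delta sub_nonterminal sub_dim (inr c) void (of_void _)
    (fun=> map inr w) (@constant_linear w).

Definition start_nt k := sub_nt (ng_start (G k)).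

Definition start_index k : 'I_(sub_dim (start_nt k)) :=
  Ordinal (ng_dim_gt0 (ng_start (G k))).

Definition start_var k : {_ : unit & 'I_(sub_dim (start_nt k))} :=
  @Tagged unit tt (fun _ => 'I_(sub_dim (start_nt k))) (start_index k).

Lemma start_linear k :
  linear_template (fun _ : 'I_1 => [:: inl (start_var k)] : seq (_ + Delta)).
Proof. by move=> v j [|p] j' [|p'] /=; rewrite ?onth0n // !ord1. Qed.

Definition start_rule k : named_rule Delta sub_dim :=
  @NamedRule Delta sub_nonterminal sub_dim (inr (Some (inl k))) unit
    (fun=> start_nt k) (fun=> [:: inl (start_var k)]) (@start_linear k).

Definition sub_rule (l : sub_label) : named_rule Delta sub_dim :=
  match l with
  | inl l => copied_rule (tagged l)
  | inr None => constant_rule None [::]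
  | inr (Some (inr a)) => constant_rule (Some (inr a)) [:: a]
  | inr (Some (inl k)) => start_rule k
  end.

Definition sub_labels : set sub_label :=
  [set l | match l with inl l => ng_labels (tagged l) | inr _ => True end].

Lemma sub_labels_finite : finite_set sub_labels.
Proof.
apply: (@sub_finite_set _ _ ((\bigcup_(k in [set: K])
  ((fun l => inl (Tagged (fun k => ng_label (G k)) l) : sub_label) @` @ng_labels _ (G k)))
  `|` range inr)).
  by case=> [[k l]|c] /= h; [left; exists k => //; exists l|right; exists c].
rewrite finite_setU; split; last exact: finite_image.
by apply: bigcup_finite => // k _; apply/finite_image/ng_labels_finite.
Qed.

Definition sub_grammar : named_grammar Delta :=
  @NamedGrammar Delta sub_nonterminal sub_dim sub_dim_gt0
    (start_nt k0) (ng_dim_start (G k0)) sub_label sub_rule _ sub_labels_finite.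

Definition sub_sound_at (A : sub_nonterminal) : ('I_(sub_dim A) -> seq Delta) -> Prop :=
  match A with
  | inl kA => fun z => exists2 x, generates (G:=G (tag kA)) (A:=tagged kA) x &
      forall j, expands (x j) (z j)
  | inr (Some c) => fun z => expands [:: c] (z ord0)
  | inr None => fun z => z ord0 = [::]
  end.

Lemma named_language_start k x (j : 'I_(ng_dim (ng_start (G k)))) :
  generates (G:=G k) x -> R k (x j).
Proof.
move=> xgen; rewrite GE /named_language /=; congr generates: xgen.
apply/funext => i; congr x; apply: val_inj.
have lt1 (i' : 'I_(ng_dim (ng_start (G k)))) : val i' = 0.
  by case: i' => i' /=; rewrite ng_dim_start; case: i'.
by rewrite !lt1.
Qed.

Lemma sub_sound A z : generates (G:=sub_grammar) (A:=A) z -> sub_sound_at z.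
Proof.
elim=> -[[k l]|[[k|a]|]] y /= ll _ IH.
- pose Y i := s2val (cid2 (IH (inl i))).
  have Ygen i : generates (Y i) := s2valP (cid2 (IH (inl i))).
  have Yexp i := s2valP' (cid2 (IH (inl i))).
  pose y' (v : rule_var l) := Y (tag v) (tagged v).
  have letter_exp jp : expands (subst_letter y' (letter_at jp)) (y (copied_letter jp)).
    have := IH (inr jp); rewrite /sub_sound_at /copied_rhs /copied_letter.
    by case: (letter_at jp) => [v|c] //= _; have := Yexp (tag v) (tagged v).
  exists (fun j => subst_word y' (rule_tmpl j)); first exact: generates_rule.
  move=> j; rewrite subst_rule_tmpl subst_copied_tmpl; apply: expands_seq => p.
  exact: letter_exp.
- have [x xgen /(_ (start_index k)) xexp] := IH tt.
  exact: (expands_rule (named_language_start _ xgen) xexp expands_nil).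
- exact/expands_letter/expands_nil.
- by [].
Qed.

(** This is [expands] with the recursive part replaced by derivability in [sub_grammar]. It
    separates the two inductions: [sub_complete_copy] runs over a derivation in [G k],
    [sub_complete] over the nesting. *)
Inductive letterwise : seq (K + Delta) -> seq Delta -> Prop :=
| letterwise_nil : letterwise [::] [::]
| letterwise_cons c x w w' :
    generates (G:=sub_grammar) (A:=inr (Some c)) (fun=> w) ->
    letterwise x w' -> letterwise (c :: x) (w ++ w').

Lemma letterwise1 c w : letterwise [:: c] w ->
  generates (G:=sub_grammar) (A:=inr (Some c)) (fun=> w).
Proof.
move=> h; inversion h as [|? ? w1 w2 h1 h2]; subst.
by inversion h2; rewrite cats0.
Qed.

Lemma letterwise_flatten (T : eqType) (X : T -> seq (K + Delta)) s z :
  uniq s -> letterwise (flatten (map X s)) z ->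
  exists Z, (forall p, p \in s -> letterwise (X p) (Z p)) /\ z = flatten (map Z s).
Proof.
have catI x x' w : letterwise (x ++ x') w ->
    exists w1 w2, [/\ w = w1 ++ w2, letterwise x w1 & letterwise x' w2].
  elim: x w => [|c x IH] w /=; first by exists [::], w; split=> //; apply: letterwise_nil.
  move=> h; inversion h as [|? ? w0 w' h1 h2]; subst.
  have [w1 [w2 [-> l1 l2]]] := IH _ h2.
  by exists (w0 ++ w1), w2; split; rewrite ?catA //; apply: letterwise_cons.
elim: s z => [|p s IH] z /=.
  by move=> _ h; inversion h; exists (fun=> [::]).
move=> /andP [ps us] /catI [w1 [w2 [-> l1 /IH]]] /(_ us) [Z [ZP ->]].
exists (fun q => if q == p then w1 else Z q); split.
  by move=> q; rewrite inE; case: eqP => [-> //|_] /= /ZP.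
rewrite eqxx; congr (_ ++ flatten _); apply/eq_in_map => q qs.
by case: eqP ps => // <-; rewrite qs.
Qed.

Lemma sub_complete_copy k A x : generates (G:=G k) (A:=A) x ->
  forall z, (forall j, letterwise (x j) (z j)) ->
  generates (G:=sub_grammar) (A:=sub_nt A) z.
Proof.
elim=> l y ll gen IH z xz.
have zP j : exists Z : 'I_(size (rule_tmpl (l:=l) j)) -> seq Delta,
    (forall p, letterwise (subst_letter y (letter_at (Tagged _ p))) (Z p)) /\
    z j = flatten (map Z (enum 'I__)).
  have := xz j; rewrite -[@nrule_tmpl _ _ _ _ j]/(rule_tmpl j) subst_rule_tmpl.
  move=> /letterwise_flatten [|Z [ZP ->]]; first exact: enum_uniq.
  by exists Z; split=> // p; apply: ZP; rewrite mem_enum.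
pose Z j := sval (cid (zP j)).
have ZP j p : letterwise (subst_letter y (letter_at (Tagged _ p))) (Z j p).
  by have [+ _] := svalP (cid (zP j)); apply.
have zE j : z j = flatten (map (Z j) (enum 'I__)) by have [] := svalP (cid (zP j)).
pose B j := map (Z j) (enum 'I__).
have sz j : size (B j) = size (rule_tmpl j) by rewrite size_map size_enum_ord.
have [g [gP gdef]] := linear_pick (fun v => [::]) (@nrule_linear _ _ _ (ng_rule l)) sz.
have onthB j (p : 'I_(size (rule_tmpl j))) : onth (B j) p = Some (Z j p).
  by rewrite onth_map onthE (nth_map p) ?size_enum_ord // nth_ord_enum.
have glet v : letterwise (y v) (g v).
  have [[j [k' [tk bk]]]|[no ->]] := gdef v.
    have lt : k' < size (rule_tmpl j) by rewrite -onthTE [onth _ _]tk.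
    have := onthB j (Ordinal lt); rewrite /= bk => -[->].
    have := ZP j (Ordinal lt); have := onth_letter_at (Ordinal lt).
    by rewrite /= [onth _ _]tk => -[<-].
  (* The content of an erased variable might have no expansion; trimming makes it the empty word,
     which expands to itself. *)
  have [[j [k' tk]]|->] := Gtrim ll gen v; last exact: letterwise_nil.
  by case: (no j k').
(* Old variables receive the expansions of their contents, letter positions the expansion [Z] of
   their letter, and positions holding a variable the empty word. *)
pose y' (u : {i : copied_idx l & 'I_(sub_dim (copied_rhs i))}) : seq Delta :=
  match u with
  | existT (inl i) k => g (Tagged (fun i => 'I_(ng_dim (nrule_rhs i))) k)
  | existT (inr jp) _ => if letter_at jp is inl _ then [::] else Z (tag jp) (tagged jp)
  end.
pose L : sub_label := inl (Tagged (fun k => ng_label (G k)) l).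
have := @generates_rule Delta sub_grammar L y' ll.
have h i : generates (G:=sub_grammar) (A:=copied_rhs i)
   (fun j => y' (Tagged (fun i => 'I_(sub_dim (copied_rhs i))) j)).
  case: i => [i|[j p]] /=.
    by apply: IH => k'; apply: glet.
  have := ZP j p; case E: (letter_at _) => [v|c] /=.
    move=> _; have := @generates_rule Delta sub_grammar (inr None) (fun=> [::]) I.
    by move=> /(_ (fun i => match i with end)).
  exact: letterwise1.
move=> /(_ h); congr generates; apply/funext => j.
rewrite /= subst_copied_tmpl zE; congr flatten; apply: eq_map => p.
rewrite /copied_letter; case E: (letter_at _) => [v|c] /=; last by rewrite E.
have := onth_letter_at p; rewrite E => tp.
by rewrite -(gP _ _ _ _ tp (onthB j p)); congr g; case: (v).
Qed.

Lemma sub_complete x w : expands x w -> letterwise x w.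
Proof.
elim=> {x w} [|a x w _ IH|k y x w w' ky _ IH1 _ IH2].
- exact: letterwise_nil.
- apply: (@letterwise_cons _ _ [:: a] _ _ IH).
  have := @generates_rule Delta sub_grammar (inr (Some (inr a))) (fun=> [::]) I.
  by move=> /(_ (fun i => match i with end)).
- apply: letterwise_cons IH2; move: ky; rewrite GE => /sub_complete_copy kgen.
  have := @generates_rule Delta sub_grammar (inr (Some (inl k))) (fun=> w) I.
  move=> /(_ (fun=> kgen _ (fun=> IH1))).
  by congr generates; apply/funext => j; rewrite /= /subst_word /= cats0.
Qed.

Lemma sub_language : named_language sub_grammar = [set w | expands [:: inl k0] w].
Proof.
rewrite predeqE => w; rewrite /named_language /=; split.
  move=> /sub_sound [x xgen /(_ (start_index k0)) xw].
  rewrite -[w]cats0.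
  exact: (expands_rule (named_language_start _ xgen) xw expands_nil).
move=> h; inversion h as [| |? y ? w1 w2 ky yw nw]; subst.
inversion nw; subst; rewrite cats0.
move: ky; rewrite GE => /sub_complete_copy; apply=> j.
exact: sub_complete.
Qed.

End SubstitutionGrammar.

(** Since [K] is finite, trimmed grammars for all the [R k] can be merged into one finite
    grammar. *)
Theorem nested_substitution_mcf k : (forall k, multiple_context_free (R k)) ->
  multiple_context_free [set w | expands [:: inl k] w].
Proof.
move=> mcfR.
have [G [GE Gtrim]] : exists G, (forall k, R k = named_language (G k)) /\ (forall k, trimmed (G k)).
  pose h k := cid2 ((multiple_context_free_trimmedP (R k)).1 (mcfR k)).
  by exists (fun k => s2val (h k)); split=> k0; [exact: (s2valP' (h k0))|exact: (s2valP (h k0))].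
by apply/multiple_context_freeP; exists (sub_grammar G k); rewrite sub_language.
Qed.

End NestedSubstitution.

(** * Britton's lemma *)

Section StackMachine.
Variables (P : groupType) (D : eqType) (rev_dart : D -> D).
(* [transfer d] is the graph of a partial isomorphism between two subgroups of *)
(* P: the stable letter d satisfies x d = d y whenever [transfer d x y].       *)
Variable transfer : D -> P -> P -> Prop.

Hypothesis rev_dartK : involutive rev_dart.
Hypothesis transfer_sym : forall d x y, transfer d x y -> transfer (rev_dart d) y x.
Hypothesis transfer1 : forall d, transfer d 1%g 1%g.
Hypothesis transferM : forall d x y x' y',
  transfer d x y -> transfer d x' y' -> transfer d (x * x')%g (y * y')%g.
Hypothesis transferV : forall d x y, transfer d x y -> transfer d x^-1%g y^-1%g.
Hypothesis transfer_fun : forall d x y y', transfer d x y -> transfer d x y' -> y = y'.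

Local Open Scope group_scope.

Definition in_dom d x := exists y, transfer d x y.

Definition image d x : P := xget 1 [set y | transfer d x y].

(** [xget] sees only the set of candidates, the left coset of [g] modulo the domain of [d]; hence
    elements of one coset get the same representative. *)
Definition coset_rep d g : P := xget 1 [set t | in_dom d (t^-1 * g)].

Lemma imageE d x y : transfer d x y -> image d x = y.
Proof. by move=> xy; apply: xget_unique => // z xz; apply: transfer_fun xz xy. Qed.

Lemma in_domE d x : in_dom d x -> transfer d x (image d x).
Proof. by move=> [y xy]; rewrite (imageE xy). Qed.

Lemma in_domMr d x y : in_dom d y -> in_dom d (x * y) <-> in_dom d x.
Proof.
move=> [y' yy']; split=> [[z xz]|[z xz]]; last by exists (z * y'); apply: transferM.
by exists (z * y'^-1); rewrite -[x](mulgK y); apply: transferM => //; apply: transferV.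
Qed.

Lemma coset_repP d g : in_dom d ((coset_rep d g)^-1 * g).
Proof. apply: (@xgetPex _ 1 [set t | in_dom d (t^-1 * g)]).
by exists g; exists 1 => /=; rewrite mulVg; apply: transfer1. Qed.

Lemma coset_rep_mul d g x : in_dom d x -> coset_rep d (g * x) = coset_rep d g.
Proof.
move=> dx; congr xget; rewrite predeqE => t /=.
by rewrite mulgA; apply: in_domMr.
Qed.

Lemma coset_rep_eq d g h : in_dom d (h^-1 * g) -> coset_rep d g = coset_rep d h.
Proof. by move=> dx; rewrite -(mulVKg h g) coset_rep_mul. Qed.

(** With the top of the stack listed first, a state stands for the normal form t_1 d_1 ... t_n d_n
    g, on which letters act by right multiplication. *)
Definition state : Type := (seq (D * P) * P)%type.

Definition push d (s : state) : state :=
  ((d, coset_rep d s.2) :: s.1, image d ((coset_rep d s.2)^-1 * s.2)).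

Definition dart_act d (s : state) : state :=
  match s.1 with
  | (d', t) :: st =>
    if (d' == rev_dart d) && `[< in_dom d s.2 >] then (st, t * image d s.2)
    else push d s
  | [::] => push d s
  end.

(** Britton's normal form: the t_i are chosen coset representatives, and there is no d^-1 t d with t
    in the domain of d. *)
Fixpoint reduced (st : seq (D * P)) : Prop :=
  match st with
  | (d, t) :: st' =>
    [/\ coset_rep d t = t,
        match st' with (d', _) :: _ => d' = rev_dart d -> ~ in_dom d t | _ => True end
      & reduced st']
  | [::] => True
  end.

Lemma coset_rep_idem d g : coset_rep d (coset_rep d g) = coset_rep d g.
Proof. by apply/esym/coset_rep_eq/coset_repP. Qed.

Lemma in_dom_rep d g : in_dom d (coset_rep d g) <-> in_dom d g.
Proof.
by rewrite -[X in _ <-> in_dom d X](mulVKg (coset_rep d g)) in_domMr //; apply: coset_repP.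
Qed.

Lemma push_reduced d s : reduced s.1 ->
  (if s.1 is (d', _) :: _ then d' = rev_dart d -> ~ in_dom d s.2 else True) ->
  reduced (push d s).1.
Proof.
case: s => [[|[d' t] st] g] rst dom /=; rewrite coset_rep_idem; split=> //.
by move=> /dom; rewrite in_dom_rep.
Qed.

Lemma dart_act_reduced d s : reduced s.1 -> reduced (dart_act d s).1.
Proof.
case: s => [[|[d' t] st] g] rst; rewrite /dart_act /=.
  exact: (@push_reduced d ([::], g)).
case: ifP => [_|/negbT]; first by case: rst.
rewrite negb_and => /orP no; apply: (@push_reduced d (_ :: _, g)) => //= dd dom.
by case: no => [/eqP //|/asboolP].
Qed.

(** A push is undone by a pop. A pop is undone by a push because the stacked [t] is its own
    representative and reducedness rules out a second pop. *)
Lemma dart_actK d s : reduced s.1 -> dart_act (rev_dart d) (dart_act d s) = s.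
Proof.
have pushK s' : dart_act (rev_dart d) (push d s') = s'.
  case: s' => st g; rewrite /push /dart_act /= rev_dartK eqxx /=.
  have tr := in_domE (coset_repP d g); have tr' := transfer_sym tr.
  rewrite asboolT; last by eexists; exact: tr'.
  by rewrite (imageE tr') mulVKg.
case: s => [[|[d' t] st] g] rst; rewrite {2}/dart_act /=.
  exact: (pushK ([::], g)).
case: ifP => [/andP [/eqP dd' /asboolP dom]|_]; last exact: pushK.
subst d'; case: rst => /= tt nodom rst.
have tr := in_domE dom; have tr' := transfer_sym tr.
have dom' : in_dom (rev_dart d) (image d g) by eexists; exact: tr'.
have pushE : push (rev_dart d) (st, t * image d g) = ((rev_dart d, t) :: st, g).
  by rewrite /push /= coset_rep_mul // tt mulKg (imageE tr').
rewrite /dart_act /=; case: st nodom rst pushE => [|[d' t'] st] //= nodom rst pushE.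
case: ifP => // /andP [/eqP dd' /asboolP].
by rewrite in_domMr // => /(nodom dd').
Qed.

(** The relation x d = d y holds in the action: a factor in the domain of [d] changes neither the
    coset nor the choice between pushing and popping. *)
Lemma dart_act_transfer d st g x y : transfer d x y ->
  dart_act d (st, g * x) =
  ((dart_act d (st, g)).1, (dart_act d (st, g)).2 * y).
Proof.
move=> xy; have dx : in_dom d x by exists y.
have imM h : in_dom d h -> image d (h * x) = image d h * y.
  by move=> /in_domE tr; apply/imageE/transferM.
have pushE : push d (st, g * x) = ((push d (st, g)).1, (push d (st, g)).2 * y).
  by rewrite /push /= coset_rep_mul // mulgA imM //; apply: coset_repP.
rewrite /dart_act /=; case: st pushE => [|[d' t] st] pushE //.
rewrite (_ : `[< in_dom d (g * x) >] = `[< in_dom d g >]); last exact/asbool_equiv_eq/in_domMr.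
by case: ifP => // /andP [_ /asboolP dom]; rewrite /= imM // mulgA.
Qed.

Definition letter_act (s : state) (c : P + D) : state :=
  match c with inl p => (s.1, s.2 * p) | inr d => dart_act d s end.

Definition word_act (w : seq (P + D)) (s : state) : state := foldl letter_act s w.

Lemma word_act_cat u w s : word_act (u ++ w) s = word_act w (word_act u s).
Proof. exact: foldl_cat. Qed.

Lemma word_act_reduced w s : reduced s.1 -> reduced (word_act w s).1.
Proof.
elim: w s => //= c w IH s rs; apply: IH.
by case: c => [p|d] //; apply: dart_act_reduced.
Qed.

Section Parsing.
Variables (L : Type) (read : L -> P + D).

Inductive loop : seq L -> P -> Prop :=
| loop_nil : loop [::] 1
| loop_elt l p u x : read l = inl p -> loop u x -> loop (l :: u) (p * x)
| loop_dart l l' d u w x y z :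
    read l = inr d -> read l' = inr (rev_dart d) -> loop u y -> transfer d x y ->
    loop w z -> loop (l :: u ++ l' :: w) (x * z).

Lemma loop_cat u w x y : loop u x -> loop w y -> loop (u ++ w) (x * y).
Proof.
elim=> [|l p {}u {}x lp _ IH|l l' d u1 u2 x1 y1 z1 ld ld' l1 _ tr _ IH] lw.
- by rewrite mul1g.
- by rewrite -mulgA; apply: loop_elt lp (IH lw).
- by rewrite -mulgA /= -catA; apply: loop_dart ld ld' l1 tr (IH lw).
Qed.

(* [parsed w st g]: the word w brings the machine from ([::], 1) to (st, g)    *)
(* and splits into loops separated by the stacked darts.                       *)
Inductive parsed : seq L -> seq (D * P) -> P -> Prop :=
| parsed_bottom u x : loop u x -> parsed u [::] x
| parsed_push w st t d x y l u z :
    parsed w st (t * x) -> transfer d x y -> read l = inr d -> loop u z ->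
    parsed (w ++ l :: u) ((d, t) :: st) (y * z).

Lemma parsed_loop w st g u x : parsed w st g -> loop u x -> parsed (w ++ u) st (g * x).
Proof.
case=> [u1 x1 l1|w1 st1 t d x1 y1 l u1 z1 pw tr ld l1] lu.
  exact/parsed_bottom/loop_cat.
rewrite -catA -mulgA; apply: parsed_push tr _ _ => //.
exact: loop_cat.
Qed.

(** A push opens a new level of the parse; a pop closes the last level, which becomes an excursion
    in the loop below it. *)
Lemma parsed_letter w st g l : parsed w st g ->
  parsed (w ++ [:: l]) (letter_act (st, g) (read l)).1 (letter_act (st, g) (read l)).2.
Proof.
case E: (read l) => [p|d] /= pw.
  apply: parsed_loop pw _; rewrite -[p]mulg1.
  exact: loop_elt E loop_nil.
have pushP : parsed (w ++ [:: l]) (push d (st, g)).1 (push d (st, g)).2.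
  rewrite /push /= -[image d _]mulg1.
  apply: (parsed_push (x := (coset_rep d g)^-1 * g)) (loop_nil) => //.
    by rewrite mulVKg.
  exact/in_domE/coset_repP.
rewrite /dart_act /=; case: st pw pushP => [|[d' t] st] pw pushP //.
case: ifP => // /andP [/eqP dd' /asboolP dom] /=; clear pushP.
inversion pw as [|w1 ? ? ? x y l1 u z pw1 tr ld lu]; subst.
have trg := in_domE dom.
(* The current element is [y * z], with [y] left by the push and [z] the value of the loop since
   then. Both [y] and [y * z] lie in the domain of [d], hence so does [z]. *)
have trz : transfer d z (x^-1 * image d (y * z)).
  rewrite -[z in transfer d z _](mulKg y); apply: transferM => //.
  by rewrite -[d]rev_dartK; apply/transfer_sym/transferV.
rewrite -[image d _](mulVKg x) mulgA -catA /=; apply: (parsed_loop pw1).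
rewrite -[x^-1 * _]mulg1; apply: loop_dart ld _ lu _ loop_nil.
  by rewrite rev_dartK.
exact: transfer_sym.
Qed.

(** A parse that ends with the empty stack consists of a single loop, whose value is the final group
    element. *)
Theorem trivial_action_loop w : word_act (map read w) ([::], 1) = ([::], 1) -> loop w 1.
Proof.
have pw u v st g : parsed u st g ->
    parsed (u ++ v) (word_act (map read v) (st, g)).1 (word_act (map read v) (st, g)).2.
  elim: v u st g => [|l v IH] u st g pu /=; first by rewrite cats0.
  rewrite -cat1s catA [word_act _ _]/(word_act _ _) /=.
  have := parsed_letter l pu; case: (letter_act _ _) => st' g' /=; exact: IH.
have := pw [::] w [::] 1 (parsed_bottom loop_nil) => + E; rewrite E /= => h.
by inversion h.
Qed.

End Parsing.

End StackMachine.

(** * Action of the fundamental group on stacks *)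

Definition vprod (GG : graph_of_groups) : Type := forall v : gvertex GG, vgroup v.

HB.instance Definition _ GG := gen_eqMixin (vprod GG).
HB.instance Definition _ GG := gen_choiceMixin (vprod GG).

Section VertexProduct.
Variable GG : graph_of_groups.
Local Open Scope group_scope.

Let vprod_one : vprod GG := fun _ => 1.
Let vprod_mul (x y : vprod GG) : vprod GG := fun v => x v * y v.
Let vprod_inv (x : vprod GG) : vprod GG := fun v => (x v)^-1.

Let vprod_mulA : associative vprod_mul.
Proof. by move=> x y z; apply: functional_extensionality_dep => v; apply: mulgA. Qed.
Let vprod_mul1 : left_id vprod_one vprod_mul.
Proof. by move=> x; apply: functional_extensionality_dep => v; apply: mul1g. Qed.
Let vprod_mulr1 : right_id vprod_one vprod_mul.
Proof. by move=> x; apply: functional_extensionality_dep => v; apply: mulg1. Qed.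
Let vprod_mulV : left_inverse vprod_one vprod_inv vprod_mul.
Proof. by move=> x; apply: functional_extensionality_dep => v; apply: mulVg. Qed.
Let vprod_mulrV : right_inverse vprod_one vprod_inv vprod_mul.
Proof. by move=> x; apply: functional_extensionality_dep => v; apply: mulgV. Qed.

HB.instance Definition _ := isGroup.Build (vprod GG)
  vprod_mulA vprod_mul1 vprod_mulr1 vprod_mulV vprod_mulrV.

Lemma vprodM (x y : vprod GG) v : (x * y) v = x v * y v. Proof. by []. Qed.
Lemma vprod1 v : (1 : vprod GG) v = 1. Proof. by []. Qed.

Definition vinj v (g : vgroup v) : vprod GG := dfwith (fun=> 1) g.

Lemma vinjE v (g : vgroup v) : vinj g v = g.
Proof. exact: dfwith_in. Qed.

Lemma vinj_inj v : injective (@vinj v).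
Proof. by move=> g h /(congr1 (@^~ v)); rewrite !vinjE. Qed.

Lemma vinjM v (g h : vgroup v) : vinj (g * h) = vinj g * vinj h.
Proof.
apply: functional_extensionality_dep => u; rewrite vprodM /vinj.
by case: (eqVneq v u) => [<-|ne]; rewrite ?dfwith_in // !dfwith_out // mulg1.
Qed.

Lemma vinj1 v : vinj (1 : vgroup v) = 1.
Proof. by apply: (mulgI (vinj (1 : vgroup v))); rewrite -vinjM !mulg1. Qed.

(** The Boolean picks the end: [edge_elt d.2] lives at the origin of the dart [d],
    [edge_elt (~~ d.2)] at its end. *)
Definition edge_elt (e : gedge GG) (b : bool) (c : egroup e) : vprod GG :=
  if b then vinj (src_mono e c) else vinj (tgt_mono e c).

Lemma edge_eltM e b (c c' : egroup e) :
  edge_elt b (c * c') = edge_elt b c * edge_elt b c'.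
Proof. by case: b; rewrite /edge_elt gmulfM vinjM. Qed.

Lemma edge_elt1 e b : edge_elt b (1 : egroup e) = 1.
Proof. by apply: (mulgI (edge_elt b (1 : egroup e))); rewrite -edge_eltM !mulg1. Qed.

Lemma edge_eltV e b (c : egroup e) : edge_elt b c^-1 = (edge_elt b c)^-1.
Proof. by apply: (mulgI (edge_elt b c)); rewrite -edge_eltM !mulgV edge_elt1. Qed.

Lemma edge_elt_inj e b : injective (@edge_elt e b).
Proof.
case: b => c c' /vinj_inj; first exact: src_mono_inj.
exact: tgt_mono_inj.
Qed.

Lemma edge_elt_supp e b (c : egroup e) :
  edge_elt b c = vinj (edge_elt b c (dart_origin (e, b))).
Proof. by case: b; rewrite /edge_elt /dart_origin /= vinjE. Qed.

Definition dart_rev (d : dart GG) : dart GG := (d.1, ~~ d.2).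

Lemma dart_revK : involutive dart_rev.
Proof. by case=> e b; rewrite /dart_rev /= negbK. Qed.

Lemma dart_origin_rev d : dart_origin (dart_rev d) = dart_end d.
Proof. by case: d => e []. Qed.

Lemma dart_end_rev d : dart_end (dart_rev d) = dart_origin d.
Proof. by case: d => e []. Qed.

Definition edge_transfer (d : dart GG) (x y : vprod GG) : Prop :=
  exists c : egroup d.1, x = edge_elt d.2 c /\ y = edge_elt (~~ d.2) c.

Lemma edge_transfer_sym d x y : edge_transfer d x y -> edge_transfer (dart_rev d) y x.
Proof. by move=> [c [-> ->]]; exists c; rewrite /= negbK. Qed.

Lemma edge_transfer1 d : edge_transfer d 1 1.
Proof. by exists 1; rewrite !edge_elt1. Qed.

Lemma edge_transferM d x y x' y' : edge_transfer d x y -> edge_transfer d x' y' ->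
  edge_transfer d (x * x') (y * y').
Proof. by move=> [c [-> ->]] [c' [-> ->]]; exists (c * c'); rewrite !edge_eltM. Qed.

Lemma edge_transferV d x y : edge_transfer d x y -> edge_transfer d x^-1 y^-1.
Proof. by move=> [c [-> ->]]; exists c^-1; rewrite !edge_eltV. Qed.

Lemma edge_transfer_fun d x y y' : edge_transfer d x y -> edge_transfer d x y' -> y = y'.
Proof. by move=> [c [-> ->]] [c' [/edge_elt_inj -> ->]]. Qed.

Definition gread (c : gletter GG) : vprod GG + dart GG :=
  match c with inl vg => inl (vinj (tagged vg)) | inr d => inr d end.

Definition gact (w : seq (gletter GG)) : state (vprod GG) (dart GG) -> state _ _ :=
  word_act dart_rev edge_transfer (map gread w).

Lemma gact_cat u w s : gact (u ++ w) s = gact w (gact u s).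
Proof. by rewrite /gact map_cat word_act_cat. Qed.

Notation greduced := (reduced dart_rev edge_transfer).

Lemma gact_reduced w s : greduced s.1 -> greduced (gact w s).1.
Proof.
exact: (word_act_reduced (@edge_transfer1) edge_transferM edge_transferV).
Qed.

Definition dart_word (p : seq (dart GG)) : seq (gletter GG) := map inr p.

Lemma dart_word_cat p q : dart_word (p ++ q) = dart_word p ++ dart_word q.
Proof. exact: map_cat. Qed.

Lemma gact_dartK d s : greduced s.1 -> gact [:: inr d; inr (dart_rev d)] s = s.
Proof.
exact: (dart_actK dart_revK edge_transfer_sym (@edge_transfer1) edge_transferM
  edge_transferV edge_transfer_fun).
Qed.

Definition walk_rev (p : seq (dart GG)) := rev (map dart_rev p).

Lemma walk_revK : involutive walk_rev.
Proof. by move=> p; rewrite /walk_rev map_rev revK mapK //; apply: dart_revK. Qed.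

Lemma gact_walk_rev p s : greduced s.1 -> gact (dart_word (p ++ walk_rev p)) s = s.
Proof.
elim: p s => [//|d p IH] s rs.
have -> : (d :: p) ++ walk_rev (d :: p) = [:: d] ++ (p ++ walk_rev p) ++ [:: dart_rev d].
  by rewrite /walk_rev /= rev_cons -cats1 catA.
rewrite dart_word_cat gact_cat dart_word_cat gact_cat IH; last exact: gact_reduced.
exact: gact_dartK.
Qed.

Lemma gact_walk_revK p s : greduced s.1 -> gact (dart_word (walk_rev p ++ p)) s = s.
Proof. by rewrite -{2}(walk_revK p); apply: gact_walk_rev. Qed.

Variable T : {set gedge GG}.

Lemma walk_catP u p q w :
  walk T u (p ++ q) w <-> exists2 v, walk T u p v & walk T v q w.
Proof.
elim: p u => [|d p IH] u /=.
  by split=> [uw|[v /eqP <-]] //; exists u.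
split; first by move=> /and3P [-> -> /IH [v pv qv]]; exists v.
by move=> [v /and3P [-> -> pv] qv]; apply/IH; exists v.
Qed.

Lemma walk_revP u p v : walk T u p v -> walk T v (walk_rev p) u.
Proof.
elim: p u => [|d p IH] u /=; first by rewrite eq_sym.
move=> /and3P [dT /eqP <- /IH wp]; rewrite /walk_rev /= rev_cons -cats1.
apply/walk_catP; exists (dart_end d) => //=.
by rewrite dT dart_origin_rev dart_end_rev !eqxx.
Qed.

Lemma not_uniq_map (A : Type) (B : eqType) (f : A -> B) s : ~~ uniq (map f s) ->
  exists a (x : A) b (y : A) c, s = a ++ x :: b ++ y :: c /\ f x = f y.
Proof.
elim: s => //= x s IH; rewrite negb_and negbK => /orP [|/IH].
  have memP s' : f x \in map f s' -> exists b (y : A) c, s' = b ++ y :: c /\ f x = f y.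
    elim: s' => //= z s' IH'; rewrite inE => /orP [/eqP fxz|/IH' [b [y [c [-> fxy]]]]].
      by exists [::], z, s'.
    by exists (z :: b), y, c.
  by move=> /memP [b [y [c [-> fxy]]]]; exists [::], x, b, y, c.
by move=> [a [y [b [z [c [-> fyz]]]]]]; exists (x :: a), y, b, z, c.
Qed.

Hypothesis acyclic : forall u p, walk T u p u -> uniq [seq d.1 | d <- p] -> p = [::].

(* A nonempty closed walk uses an edge twice, hence splits into shorter closed *)
(* walks.                                                                      *)
Lemma gact_closed_walk u p s : walk T u p u -> greduced s.1 ->
  gact (dart_word p) s = s.
Proof.
have [n] := ubnP (size p); elim: n u p s => // n IH u p s; rewrite ltnS => szp wp rs.
have [up|/(@not_uniq_map (dart GG)) [p1 [d [p2 [d' [p3 [pE dd']]]]]]] :=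
  boolP (uniq [seq d.1 | d <- p]); first by rewrite (acyclic wp up).
subst p; move: szp; rewrite size_cat /= size_cat /= => szp.
move: wp; rewrite walk_catP => -[v1 w1 /= /and3P [dT /eqP o1]].
rewrite walk_catP => -[v2 w2 /= /and3P [dT' /eqP o2 w3]].
have IH1 v q t : size q < size p1 + (size p2 + (size p3).+1).+1 -> walk T v q v ->
    greduced t.1 -> gact (dart_word q) t = t.
  by move=> lt; apply: IH; apply: leq_trans szp.
have rp q t : greduced t.1 -> greduced (gact (dart_word q) t).1 by apply: gact_reduced.
(* If the repeated edge is crossed in the same direction, the closed walk from [d] up to [d'] is cut
   out. If it is crossed backwards, the closed walk [p2] is removed and [d] cancels against its
   reverse. *)
have [dd|dd] : d' = d \/ d' = dart_rev d.
  case: (d) (d') dd' => e b [e' b'] /= <-; rewrite /dart_rev /=.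
  by case: b b' => -[]; [left|right|right|left].
  subst d'; have c2 : walk T (dart_origin d) (d :: p2) (dart_origin d).
    by rewrite /= dT eqxx o2.
  have c13 : walk T u (p1 ++ d :: p3) u.
    by apply/walk_catP; exists v1 => //=; rewrite dT o1 eqxx.
  rewrite -cat_cons dart_word_cat gact_cat dart_word_cat gact_cat.
  rewrite (IH1 _ _ _ _ c2); [|by rewrite /=; lia|exact: rp].
  rewrite -gact_cat -dart_word_cat.
  by apply: IH1 c13 rs; rewrite size_cat /=; lia.
subst d'; have c2 : walk T (dart_end d) p2 (dart_end d) by rewrite -{2}dart_origin_rev o2.
have c13 : walk T u (p1 ++ p3) u.
  by apply/walk_catP; exists v1 => //; rewrite -o1 -(dart_end_rev d).
have -> : p1 ++ d :: p2 ++ dart_rev d :: p3 = p1 ++ [:: d] ++ p2 ++ [:: dart_rev d] ++ p3 by [].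
rewrite !(dart_word_cat, gact_cat) (IH1 _ _ _ _ c2); [|lia|exact/gact_reduced/rp].
rewrite -(gact_cat [:: _] [:: _]) gact_dartK; last exact: rp.
by rewrite -gact_cat -dart_word_cat; apply: IH1 c13 rs; rewrite size_cat; lia.
Qed.

Variables (base : gvertex GG) (path_to : gvertex GG -> seq (dart GG)).
Hypothesis path_toP : forall v, walk T base (path_to v) v.

Definition round_trip u v (w : seq (gletter GG)) : seq (gletter GG) :=
  dart_word (path_to u) ++ w ++ dart_word (walk_rev (path_to v)).

(** Each letter becomes a closed path at [base]. A bare tree edge moves the empty stack, so the
    relation making it trivial fails for the raw action; for based letters it becomes a closed walk
    in [T], which acts trivially. *)
Definition based_letter (c : gletter GG) : seq (gletter GG) :=
  match c with
  | inl vg => round_trip (tag vg) (tag vg) [:: c]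
  | inr d => round_trip (dart_origin d) (dart_end d) [:: c]
  end.

Definition based_word (w : seq (gletter GG)) := flatten (map based_letter w).

Lemma gact_round_trip_cat u v w x y s : greduced s.1 ->
  gact (round_trip u v x ++ round_trip v w y) s = gact (round_trip u w (x ++ y)) s.
Proof.
move=> rs; rewrite /round_trip -!catA !gact_cat; congr gact; congr gact.
rewrite -gact_cat -dart_word_cat gact_walk_revK //.
by do 2!apply: gact_reduced.
Qed.

Lemma gact_round_trip_nil u s : greduced s.1 -> gact (round_trip u u [::]) s = s.
Proof. by move=> rs; rewrite /round_trip /= -dart_word_cat gact_walk_rev. Qed.

Lemma gact_round_trip_eq u v x y :
  (forall s, greduced s.1 -> gact x s = gact y s) ->
  forall s, greduced s.1 -> gact (round_trip u v x) s = gact (round_trip u v y) s.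
Proof.
move=> xy s rs; rewrite /round_trip !gact_cat xy //; exact: gact_reduced.
Qed.

Lemma gact_based_relation x y s : pi1_relation T x y -> greduced s.1 ->
  gact (based_word x) s = gact (based_word y) s.
Proof.
move=> xy rs; rewrite /based_word; case: xy => [v g h|v|e b|e a|e eT] /=; rewrite ?cats0.
- rewrite gact_round_trip_cat //; apply: gact_round_trip_eq rs => -[st p] _.
  by rewrite /gact /= vinjM mulgA.
- rewrite -[RHS](gact_round_trip_nil v rs); apply: gact_round_trip_eq rs => -[st p] _.
  by rewrite /gact /= vinj1 mulg1.
- rewrite -[(e, ~~ b)]/(dart_rev (e, b)) dart_origin_rev dart_end_rev.
  rewrite gact_round_trip_cat // -[RHS](gact_round_trip_nil (dart_origin (e, b)) rs).
  by apply: gact_round_trip_eq rs => t rt; apply: (gact_dartK (e, b)).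
- rewrite gact_cat /dart_origin /dart_end /=.
  rewrite gact_round_trip_cat; last exact: gact_reduced.
  rewrite -gact_cat gact_round_trip_cat //.
  apply: gact_round_trip_eq rs => -[st p] rs.
  have := dart_act_transfer dart_rev (@edge_transfer1) edge_transferM edge_transferV
    edge_transfer_fun.
  move=> /(_ (e, false) st p (vinj (tgt_mono e a)) (vinj (src_mono e a))).
  have tr : edge_transfer (e, false) (vinj (tgt_mono e a)) (vinj (src_mono e a)) by exists a.
  move=> /(_ tr) E.
  have E0 : gact [:: vlet (tgt_mono e a)] (st, p) = (st, p * vinj (tgt_mono e a)) by [].
  rewrite E0.
  rewrite -[RHS](gact_dartK (e, false)) // /gact /= E.
  by case: (dart_act _ _ _ _).
(* The based tree edge is the closed walk in [T] from [base] to [src e], across [e], and back to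
   [base]. *)
- rewrite -[RHS](gact_closed_walk (u:=base) (p:=path_to (src e) ++ (e, true) :: walk_rev (path_to (tgt e)))) //.
    by rewrite /round_trip dart_word_cat.
  apply/walk_catP; exists (src e); first exact: path_toP.
  by rewrite /= eT eqxx; apply/walk_revP.
Qed.

Lemma gact_based_congruence x y s : pi1_congruence T x y -> greduced s.1 ->
  gact (based_word x) s = gact (based_word y) s.
Proof.
move=> xy; elim: xy s => {x y} [p q x y xy|x|x y _ IH|x y z _ IH1 _ IH2] s rs //.
- rewrite /based_word !map_cat !flatten_cat !gact_cat; congr gact.
  by apply: gact_based_relation xy _; apply: gact_reduced.
- by rewrite IH.
- by rewrite IH1 // IH2.
Qed.

(** A trivial word acts as the empty one and so fixes [([::], 1)]. The letters in [L] may carry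
    marks that the action ignores; they will tell the darts of the word from the inserted tree
    darts. *)
Theorem based_word_loop (L : Type) (to_gletter : L -> gletter GG) (u : seq L) w :
  map to_gletter u = based_word w -> pi1_congruence T w [::] ->
  loop dart_rev edge_transfer (gread \o to_gletter) u 1.
Proof.
move=> uw w1; apply: trivial_action_loop => //.
- exact: dart_revK.
- exact: edge_transfer_sym.
- exact: edge_transfer1.
- exact: edge_transferM.
- exact: edge_transferV.
- exact: edge_transfer_fun.
rewrite map_comp uw -[LHS]/(gact _ ([::], 1)).
by rewrite (gact_based_congruence w1).
Qed.

End VertexProduct.

(** * The grammar of the word problem *)

Section Presentation.
Variables (GG : graph_of_groups) (T : {set gedge GG}).
Local Open Scope group_scope.

Lemma pi1_class_cat x y : pi1_class T (x ++ y) = pi1_class T x * pi1_class T y.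
Proof. by rewrite -pi1_mulE. Qed.

Lemma pi1_class_seq w : pi1_class T w = \prod_(c <- w) pi1_class T [:: c].
Proof.
elim: w => [|c w IH]; first by rewrite big_nil.
by rewrite big_cons -IH -pi1_class_cat.
Qed.

Lemma pi1_class_rel x y : pi1_relation T x y -> pi1_class T x = pi1_class T y.
Proof. by move=> xy; apply/pi1_classP; have := cong_rel [::] [::] xy; rewrite /= !cats0. Qed.

Definition vclass v (g : vgroup v) : pi1 T := pi1_class T [:: vlet g].

Lemma vclassM v (g h : vgroup v) : vclass (g * h) = vclass g * vclass h.
Proof. by rewrite -pi1_class_cat; apply/esym/pi1_class_rel/rel_vmul. Qed.

Lemma vclass1 v : vclass (1 : vgroup v) = 1.
Proof. exact/pi1_class_rel/rel_vone. Qed.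

Lemma vclassV v (g : vgroup v) : vclass g^-1 = (vclass g)^-1.
Proof. by apply: (mulgI (vclass g)); rewrite -vclassM !mulgV vclass1. Qed.

Definition dclass (d : dart GG) : pi1 T := pi1_class T [:: inr d].

Lemma dclass_rev d : dclass (dart_rev d) = (dclass d)^-1.
Proof.
apply: (mulgI (dclass d)); rewrite mulgV -pi1_class_cat; case: d => e b.
exact/pi1_class_rel/rel_einv.
Qed.

Lemma dclass_tree d : d.1 \in T -> dclass d = 1.
Proof.
case: d => e b /= eT; have e1 : dclass (e, true) = 1 by apply/pi1_class_rel/rel_tree.
by case: b => //; rewrite -[(e, false)]/(dart_rev (e, true)) dclass_rev e1 invg1.
Qed.

Lemma dclass_conj e b (c : egroup e) :
  dclass (e, b) * vclass (edge_elt (~~ b) c (dart_origin (dart_rev (e, b)))) *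
    (dclass (e, b))^-1 =
  vclass (edge_elt b c (dart_origin (e, b))).
Proof.
have conj : (dclass (e, true))^-1 * vclass (src_mono e c) * dclass (e, true) =
    vclass (tgt_mono e c).
  rewrite -dclass_rev -[RHS](pi1_class_rel (rel_econj T c)) [RHS]pi1_class_seq.
  by rewrite !big_cons big_nil mulg1 mulgA.
case: b; rewrite /edge_elt /dart_origin /= !vinjE.
  by rewrite -conj !mulgA mulgV mul1g mulgK.
by rewrite -[(e, false)]/(dart_rev (e, true)) dclass_rev invgK.
Qed.

End Presentation.

Section FundamentalGroupGrammar.
Variables (GG : graph_of_groups) (T : {set gedge GG}).
Variable base : gvertex GG.
Variable S : forall v : gvertex GG, {fset vgroup v}.
Hypothesis Sgen : forall v, symmetric_generating_set (S v).
Variable X : forall e : gedge GG, {fset egroup e}.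
Hypothesis Xfull : forall e (c : egroup e), c \in X e.
Local Open Scope group_scope.

Notation vgen := {v : gvertex GG & S v}.
Definition gen : finType := (vgen + dart GG)%type.

Definition gen_letter (l : gen) : gletter GG :=
  match l with inl vs => vlet (val (tagged vs)) | inr d => inr d end.

Definition gen_class (l : gen) : pi1 T := pi1_class T [:: gen_letter l].

Definition pi1_gens : {fset pi1 T} := [fset gen_class l | l in {: gen}]%fset.

Lemma gen_class_in l : gen_class l \in pi1_gens.
Proof. by apply/imfsetP; exists l. Qed.

Definition label (l : gen) : pi1_gens := [` gen_class_in l]%fset.

(** Distinct letters may represent the same group element, so words over [pi1_gens] are lifted by
    surjectivity of [label] alone. *)
Lemma label_surj (a : pi1_gens) : exists l, label l = a.
Proof.
by have /imfsetP [l _ al] := valP a; exists l; apply: val_inj; rewrite /= al.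
Qed.

Lemma word_value_cat (G : groupType) (A : {fset G}) (u w : seq A) :
  word_value (u ++ w) = word_value u * word_value w.
Proof. exact: big_cat. Qed.

Lemma word_value_cons (G : groupType) (A : {fset G}) (a : A) (w : seq A) :
  word_value (a :: w) = val a * word_value w.
Proof. exact: big_cons. Qed.

Lemma word_value_nil (G : groupType) (A : {fset G}) :
  word_value ([::] : seq A) = 1.
Proof. exact: big_nil. Qed.

Lemma pi1_gens_symmetric : symmetric_generating_set pi1_gens.
Proof.
split=> [x /imfsetP [l _ ->]|g].
  apply/imfsetP; case: l => [[v s]|d] /=.
    have sV : (val s)^-1 \in S v by apply: (Sgen v).1; apply: valP.
    exists (inl (Tagged (fun v => S v) [` sV]%fset)) => //.
    exact/esym/vclassV.
  by exists (inr (dart_rev d)) => //; apply/esym/dclass_rev.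
rewrite -[g]pi1_class_repr; elim: (repr g) => [|c w [u uw]].
  by exists [::]; rewrite word_value_nil.
suff [u' u'c] : exists u' : seq pi1_gens, word_value u' = pi1_class T [:: c].
  by exists (u' ++ u); rewrite word_value_cat u'c uw -pi1_class_cat.
case: c => [[v h]|d]; last first.
  by exists [:: label (inr d)]; rewrite word_value_cons word_value_nil mulg1.
have [s <-] := (Sgen v).2 h.
exists [seq label (inl (Tagged (fun v => S v) a)) | a <- s].
elim: s => [|a s IH]; first by rewrite !word_value_nil; apply/esym/vclass1.
by rewrite /= !word_value_cons IH; apply/esym/vclassM.
Qed.

(** The pair (d, c) stands for all excursions along [d] whose value is the image of [c] at the
    origin of [d]. *)
Definition excursion : finType := {d : dart GG & X d.1}.

Definition excursion_of (d : dart GG) (c : egroup d.1) : excursion :=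
  Tagged (fun d : dart GG => X d.1) [` Xfull c]%fset.

(** The same edge element seen from the far end, where it is the value required of the inner closed
    path. *)
Definition excursion_rev (m : excursion) : excursion :=
  @Tagged _ (dart_rev (tag m)) (fun d : dart GG => X d.1) (tagged m).

Definition excursion_vertex (m : excursion) := dart_origin (tag m).

Definition excursion_value (m : excursion) : vprod GG :=
  edge_elt (tag m).2 (val (tagged m)).

(** The finitely many values that are prescribed for closed paths: 1 at a vertex, or an edge-group
    element at an end of its edge. *)
Definition target : finType := (gvertex GG + excursion)%type.

Definition target_vertex (j : target) :=
  match j with inl v => v | inr m => excursion_vertex m end.

Definition target_value (j : target) : vprod GG :=
  match j with inl v => 1 | inr m => excursion_value m end.

Definition word_of v (g : vgroup v) : seq (S v) := sval (cid ((Sgen v).2 g)).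

Lemma word_ofK v (g : vgroup v) : word_value (word_of g) = g.
Proof. exact: (svalP (cid ((Sgen v).2 g))). Qed.

Definition excursion_word v (m : excursion) := word_of (excursion_value m v).
Definition target_word v (j : target) := word_of (target_value j v)^-1.

Definition word_bound v : nat :=
  (\max_(m : excursion) size (excursion_word v m) +
   \max_(j : target) size (target_word v j))%N.

Definition wstate v : finType := (word_bound v).-bseq (S v).

Definition nil_state v : wstate v := [bseq].

Lemma target_size v j : (size (target_word v j) <= word_bound v)%N.
Proof.
apply: leq_trans (leq_addl _ _).
exact: (leq_bigmax (F:=fun j => size (target_word v j))).
Qed.

Definition target_state v j : wstate v := Bseq (target_size v j).

Lemma excursion_size v m s r : excursion_word v m = s :: r -> (size r <= word_bound v)%N.
Proof.
move=> mE; apply: leq_trans (leq_addr _ _).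
apply: leq_trans (leq_bigmax (F:=fun m => size (excursion_word v m)) m).
by rewrite mE.
Qed.

Definition nt : finType :=
  (target + excursion + vgen + gvertex GG + dart GG + bool)%type.

Definition NLoop (j : target) : nt := inl (inl (inl (inl (inl j)))).
Definition NExcursion (m : excursion) : nt := inl (inl (inl (inl (inr m)))).
Definition NGen (x : vgen) : nt := inl (inl (inl (inr x))).
(* Sequences of excursions at v of value 1, which may occur between any two    *)
(* letters.                                                                    *)
Definition NTrivial (v : gvertex GG) : nt := inl (inl (inr v)).
Definition NDart (d : dart GG) : nt := inl (inr d).
Definition NStart : nt := inr true.
Definition NEmpty : nt := inr false.

Notation symbol := (nt + pi1_gens)%type.

Definition excursion_rhs (m : excursion) : seq symbol :=
  [:: inl (NDart (tag m)); inl (NTrivial (excursion_vertex (excursion_rev m)));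
      inl (NLoop (inr (excursion_rev m))); inl (NDart (dart_rev (tag m)))].

(* The state is the rest of the word being skipped: one spelling the inverse   *)
(* of the target value at the start, then those replaced by excursions.        *)
Definition loop_step v (p : wstate v) (s : S v) (c : symbol) (q : wstate v) : Prop :=
  [\/ (p : seq _) = s :: q /\ c = inl NEmpty,
      [/\ p = nil_state v, q = nil_state v & c = inl (NGen (Tagged (fun v => S v) s))]
    | p = nil_state v /\ exists m,
        [/\ excursion_vertex m = v, excursion_word v m = s :: q
          & c = inl (NExcursion m)]].

(** The transducer consumes a letter at each step, so it cannot insert an excursion whose chosen
    word is empty. Hence the [NTrivial] after each generator and excursion and at the start of a
    closed path. Tree darts may be rewritten to nothing, being invisible in the group. *)
Definition rhs (k : nt) : set (seq symbol) :=
  match k with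
  | inl (inl (inl (inl (inl j)))) =>
      let v := target_vertex j in
      [set z | exists2 x, word_problem (S v) x &
         run (@loop_step v) (target_state v j) x z (nil_state v)]
  | inl (inl (inl (inl (inr m)))) =>
      [set z | z \in [:: excursion_rhs m ++ [:: inl (NTrivial (excursion_vertex m))]]]
  | inl (inl (inl (inr x))) =>
      [set z | z \in [:: [:: inr (label (inl x)); inl (NTrivial (tag x))]]]
  | inl (inl (inr v)) =>
      [set z | z \in [::] :: [seq [:: inl (NExcursion m)] | m <- enum excursion
          & (excursion_vertex m == v) && (excursion_word v m == [::])]]
  | inl (inr d) =>
      [set z | z \in [:: inr (label (inr d))] :: if d.1 \in T then [:: [::]] else [::]]
  | inr b =>
      [set z | z \in [:: if b then [:: inl (NTrivial base); inl (NLoop (inl base))] else [::]]]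
  end.

Hypothesis Smcf : forall v, multiple_context_free (word_problem (S v)).

Lemma rhs_mcf k : multiple_context_free (rhs k).
Proof.
case: k => [[[[[j|m]|x]|v]|d]|b]; try exact: finite_language_mcf.
exact: transduction_mcf.
Qed.

(** * Soundness: productions preserve values in the fundamental group *)

Definition nt_value (k : nt) : pi1 T :=
  match k with
  | inl (inl (inl (inl (inl j)))) => vclass T (target_value j (target_vertex j))
  | inl (inl (inl (inl (inr m)))) =>
      vclass T (excursion_value m (excursion_vertex m))
  | inl (inl (inl (inr x))) => vclass T (val (tagged x))
  | inl (inl (inr v)) => 1
  | inl (inr d) => dclass T d
  | inr b => 1
  end.

Definition symbol_value (c : symbol) : pi1 T :=
  match c with inl k => nt_value k | inr a => val a end.

(** The pending word in the state is a debt: its value times that of the output equals the value of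
    the input times that of the new debt. *)
Lemma run_value v p (x : seq (S v)) z q : run (@loop_step v) p x z q ->
  vclass T (word_value (p : seq (S v))) * \prod_(c <- z) symbol_value c =
  vclass T (word_value x) * vclass T (word_value (q : seq (S v))).
Proof.
elim=> {p x z q} [p|p q r s c x z step _ IH].
  by rewrite big_nil mulg1 word_value_nil vclass1 mul1g.
rewrite big_cons word_value_cons vclassM -mulgA -IH.
case: step => [[-> ->]|[-> -> ->]|[-> [m [mv mE ->]]]].
- by rewrite word_value_cons vclassM mul1g mulgA.
- by rewrite word_value_nil vclass1 !mul1g.
- have -> : symbol_value (inl (NExcursion m)) = vclass T (excursion_value m v).
    by rewrite -mv.
  rewrite word_value_nil vclass1 mul1g mulgA -vclassM -word_value_cons -mE.
  by rewrite word_ofK.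
Qed.

(** Each production is an equation in the group; the one for an excursion is the conjugation
    relation [dclass_conj]. *)
Lemma rhs_value k y : rhs k y -> \prod_(c <- y) symbol_value c = nt_value k.
Proof.
case: k => [[[[[j|m]|x]|v]|d]|b] /=.
- move=> [x x1 /run_value]; rewrite [word_value x]x1 word_value_nil !vclass1 mulg1.
  rewrite word_ofK vclassV => e.
  apply: (mulgI (vclass T (target_value j (target_vertex j)))^-1).
  by rewrite mulVg; exact: e.
- rewrite inE => /eqP ->; rewrite !big_cons big_nil /= !mulg1 mul1g.
  case: m => -[e b] c; rewrite dclass_rev mulgA.
  exact: (dclass_conj T b (val c)).
- by rewrite inE => /eqP ->; rewrite !big_cons big_nil /= !mulg1.
- rewrite inE => /orP [/eqP ->|]; first by rewrite big_nil.
  move=> /mapP [m]; rewrite mem_filter => /andP [/andP [/eqP <- /eqP m1] _] ->.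
  rewrite big_cons big_nil mulg1 /= -(word_ofK (excursion_value m _)).
  by rewrite [word_of _]m1 word_value_nil vclass1.
- case: ifP => dT; rewrite !inE; last by move=> /eqP ->; rewrite big_cons big_nil mulg1.
  move=> /orP [] /eqP ->; first by rewrite big_cons big_nil mulg1.
  by rewrite big_nil dclass_tree.
- by case: b; rewrite inE => /eqP ->; rewrite ?big_cons big_nil //= vprod1 vclass1 !mulg1.
Qed.

Lemma expands_value y w : expands rhs y w ->
  \prod_(c <- y) symbol_value c = word_value w.
Proof.
elim=> {y w} [|a x w _ IH|k y x w w' ky _ IH1 _ IH2].
- by rewrite big_nil word_value_nil.
- by rewrite big_cons word_value_cons IH.
- by rewrite big_cons word_value_cat /= -(rhs_value ky) IH1 IH2.
Qed.

(** * Completeness: closed paths at a vertex, cut into generators and excursions *)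

Definition block v (b : S v + excursion) (w : seq pi1_gens) : Prop :=
  match b with
  | inl s => w = [:: label (inl (Tagged (fun v => S v) s))]
  | inr m => excursion_vertex m = v /\ expands rhs (excursion_rhs m) w
  end.

Definition block_word v (b : S v + excursion) : seq (S v) :=
  match b with inl s => [:: s] | inr m => excursion_word v m end.

Inductive blocks v : seq (S v + excursion) -> seq pi1_gens -> Prop :=
| blocks_nil : blocks [::] [::]
| blocks_cons b bs w w' : block b w -> blocks bs w' -> blocks (b :: bs) (w ++ w').

Definition block_value v (b : S v + excursion) : vgroup v :=
  word_value (block_word b).

Lemma run_suffix v (p : wstate v) :
  run (@loop_step v) p p (nseq (size p) (inl NEmpty)) (nil_state v).
Proof.
case: p => p; elim: p => [|s p IH] sz /=.
  by rewrite (_ : Bseq sz = nil_state v); [apply: run_nil|apply: val_inj].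
have sz' : (size p <= word_bound v)%N by apply: ltnW.
by apply: (run_cons _ (IH sz')); constructor 1.
Qed.

Lemma expands_empty n x w : expands rhs x w -> expands rhs (nseq n (inl NEmpty) ++ x) w.
Proof.
move=> xw; elim: n => //= n IH; rewrite -[w]cat0s.
apply: expands_rule IH; last exact: expands_nil.
by rewrite /= inE.
Qed.

Lemma expands1 k y w : rhs k y -> expands rhs y w -> expands rhs [:: inl k] w.
Proof.
by move=> ky yw; rewrite -[w]cats0; apply: (expands_rule ky yw (expands_nil _)).
Qed.

Lemma expands_trivial v : expands rhs [:: inl (NTrivial v)] [::].
Proof. by apply: expands1 (expands_nil _); rewrite /= inE. Qed.

(* The blocks are absorbed from right to left; an excursion whose word is      *)
(* empty joins the trivial excursions that follow the preceding letter.        *)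
Lemma blocks_run v bs w : @blocks v bs w -> exists i w' z,
  [/\ w = i ++ w', expands rhs [:: inl (NTrivial v)] i,
      run (@loop_step v) (nil_state v) (flatten (map (@block_word v) bs)) z (nil_state v)
    & expands rhs z w'].
Proof.
elim=> {bs w} [|b bs w w' bw _ [i [w'' [z [-> iI zr zw]]]]].
  by exists [::], [::], [::]; split=> //;
    [exact: expands_trivial|exact: run_nil|exact: expands_nil].
case: b bw => [s|m] /= bw.
  exists [::], (w ++ i ++ w''), (inl (NGen (Tagged (fun v => S v) s)) :: z); split=> //.
  - exact: expands_trivial.
  - by apply: run_cons zr; constructor 2.
  rewrite catA; apply: expands_rule zw; first by rewrite /= inE.
  by rewrite bw; apply: expands_letter.
case: bw => mv wm.
have mi : expands rhs [:: inl (NExcursion m)] (w ++ i).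
  apply: (expands1 (y:=excursion_rhs m ++ [:: inl (NTrivial v)])).
    by rewrite /= mv inE.
  exact: expands_cat.
case mE: (excursion_word v m) => [|s r] /=.
  exists (w ++ i), w'', z; split=> //; first by rewrite catA.
  apply: expands1 mi; rewrite /= inE; apply/orP; right; apply/mapP; exists m => //.
  by rewrite mem_filter mv mE !eqxx mem_enum.
pose r' : wstate v := Bseq (excursion_size mE).
exists [::], (w ++ i ++ w''), (inl (NExcursion m) :: nseq (size r) (inl NEmpty) ++ z).
split=> //; first exact: expands_trivial.
  apply: (run_cons (q:=r')); first by constructor 3; split=> //; exists m.
  exact: run_cat (run_suffix r') zr.
rewrite catA -cat1s; apply: expands_cat mi _; exact: expands_empty.
Qed.

(** Prefixing the target word, which spells the inverse of the prescribed value, puts the word read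
    into the word problem; the transducer skips this prefix. *)
Lemma blocks_target j bs w : @blocks (target_vertex j) bs w ->
  \prod_(b <- bs) block_value b = target_value j (target_vertex j) ->
  expands rhs [:: inl (NTrivial (target_vertex j)); inl (NLoop j)] w.
Proof.
move=> /blocks_run [i [w' [z [-> iI zr zw]]]] value.
rewrite -cat1s; apply: expands_cat iI _.
apply: expands1 (expands_empty (size (target_word (target_vertex j) j)) zw).
exists (target_word (target_vertex j) j ++ flatten (map (@block_word _) bs)); last first.
  exact: run_cat (run_suffix (target_state _ j)) zr.
rewrite /word_problem /= word_value_cat word_ofK -(mulVg (target_value j _)).
congr (_ * _); rewrite -value; elim: (bs) => [|b bs' IH]; first by rewrite big_nil word_value_nil.
by rewrite big_cons /= word_value_cat IH.
Qed.

(* Path letters; a dart letter (d, false) is hidden, i.e. contributes nothing  *)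
(* to the word over the generators.                                            *)
Notation path_letter := (vgen + dart GG * bool)%type.

Definition to_gletter (c : path_letter) : gletter GG :=
  match c with inl x => vlet (val (tagged x)) | inr db => inr db.1 end.

Definition visible (c : path_letter) : seq pi1_gens :=
  match c with
  | inl x => [:: label (inl x)]
  | inr (d, b) => if b then [:: label (inr d)] else [::]
  end.

Definition hidden_in_tree (c : path_letter) : bool :=
  match c with inl _ => true | inr (d, b) => b || (d.1 \in T) end.

Fixpoint is_path (u : gvertex GG) (w : seq path_letter) (v : gvertex GG) : bool :=
  match w with
  | [::] => u == v
  | inl x :: w => (tag x == u) && is_path u w v
  | inr db :: w =>
      (dart_origin db.1 == u) && is_path (dart_origin (dart_rev db.1)) w v
  end.

Lemma is_path_catP u p q w :
  is_path u (p ++ q) w <-> exists2 v, is_path u p v & is_path v q w.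
Proof.
elim: p u => [|[x|db] p IH] u /=.
- by split=> [uw|[v /eqP <-]] //; exists u.
- split; first by move=> /andP [-> /IH [v pv qv]]; exists v.
  by move=> [v /andP [-> pv] qv]; apply/IH; exists v.
- split; first by move=> /andP [-> /IH [v pv qv]]; exists v.
  by move=> [v /andP [-> pv] qv]; apply/IH; exists v.
Qed.

Lemma expands_dart d b : hidden_in_tree (inr (d, b)) ->
  expands rhs [:: inl (NDart d)] (visible (inr (d, b))).
Proof.
move=> /= hid; apply: (expands1 (y := map inr (visible (inr (d, b))))) => /=.
  by case: b hid => /= [_|->]; rewrite !inE ?eqxx ?orbT.
by case: b hid => /= _; [apply: expands_letter|]; apply: expands_nil.
Qed.

(** A loop valued in the product of all vertex groups could mix vertices. The path condition keeps
    its elements and excursions at one vertex [u], so its value comes from that vertex group. *)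
Lemma loop_blocks w x :
  loop (@dart_rev GG) (@edge_transfer GG) (gread (GG:=GG) \o to_gletter) w x ->
  all hidden_in_tree w -> forall u v, is_path u w v -> u = v /\
  exists bs, @blocks u bs (flatten (map visible w)) /\
    x = vinj (\prod_(b <- bs) block_value b).
Proof.
elim=> {w x} [|[[v0 s]|//] p w x [<-] _ IH|[//|[d b]] [//|[d' b']] d0 w1 w2 x y z].
- move=> _ u v /eqP ->; split=> //; exists [::]; rewrite big_nil vinj1.
  by split=> //; apply: blocks_nil.
- move=> /= hid u v /andP [/eqP uv0]; subst v0; case/(IH hid) => <- [bs [bsw ->]].
  split=> //; exists (inl s :: bs); split; first exact: (@blocks_cons u (inl s) bs [:: _] _ erefl bsw).
  by rewrite big_cons vinjM /block_value /= word_value_cons word_value_nil mulg1.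
move=> [<-] [dd'] _ IH1 [c [-> yE]] _ IH2; subst d'.
rewrite /= all_cat /= => /and4P [hd hid1 hd' hid2] u v /andP [/eqP du].
move=> /is_path_catP [v1 /(IH1 hid1) [<- [bs1 [bs1w yE']]] /= /andP [_]].
rewrite dart_revK du => /(IH2 hid2) [<- [bs2 [bs2w ->]]]; split=> //.
pose m := excursion_of c.
(* By induction the inner loop is a sequence of blocks at the far end; its value is the edge element
   there, which is the target [excursion_rev m]. *)
have w1P : expands rhs [:: inl (NTrivial (dart_origin (dart_rev d)));
    inl (NLoop (inr (excursion_rev m)))] (flatten (map visible w1)).
  apply: (blocks_target (j:=inr (excursion_rev m)) bs1w).
  by rewrite /= /excursion_value /= -yE yE' vinjE.
exists (inr m :: bs2); split; last first.
  rewrite big_cons vinjM; congr (_ * _).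
  rewrite /block_value /= word_ofK /excursion_value /=.
  by rewrite -du; case: (d) c {yE m w1P} => e b0 c; apply: edge_elt_supp.
rewrite map_cat flatten_cat /= catA.
have -> : (visible (inr (d, b)) ++ flatten (map visible w1)) ++
    visible (inr (dart_rev d, b')) ++ flatten (map visible w2) =
  (visible (inr (d, b)) ++ flatten (map visible w1) ++
    visible (inr (dart_rev d, b'))) ++ flatten (map visible w2) by rewrite !catA.
apply: blocks_cons bs2w; split; first exact: du.
rewrite /excursion_rhs -cat1s; apply: expands_cat (expands_dart hd) _.
exact: (expands_cat w1P (@expands_dart (dart_rev d) b' hd')).
Qed.

Hypothesis acyclic : forall u p, walk T u p u -> uniq [seq d.1 | d <- p] -> p = [::].
Variable path_to : gvertex GG -> seq (dart GG).
Hypothesis path_toP : forall v, walk T base (path_to v) v.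

Definition hidden_walk (p : seq (dart GG)) : seq path_letter :=
  [seq inr (d, false) | d <- p].

Definition based_gen (l : gen) : seq path_letter :=
  match l with
  | inl x => hidden_walk (path_to (tag x)) ++ [:: inl x] ++
             hidden_walk (walk_rev (path_to (tag x)))
  | inr d => hidden_walk (path_to (dart_origin d)) ++ [:: inr (d, true)] ++
             hidden_walk (walk_rev (path_to (dart_end d)))
  end.

Definition based_gens (ls : seq gen) : seq path_letter := flatten (map based_gen ls).

Lemma to_gletter_hidden p : map to_gletter (hidden_walk p) = dart_word p.
Proof. by rewrite -map_comp. Qed.

Lemma visible_hidden p : flatten (map visible (hidden_walk p)) = [::].
Proof. by elim: p. Qed.

Lemma hidden_walk_in_tree u p v : walk T u p v -> all hidden_in_tree (hidden_walk p).
Proof. by elim: p u => //= d p IH u /and3P [-> _ /IH]. Qed.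

Lemma hidden_walk_path u p v : walk T u p v -> is_path u (hidden_walk p) v.
Proof.
by elim: p u => //= d p IH u /and3P [_ -> /IH]; rewrite dart_origin_rev.
Qed.

Lemma to_gletter_based ls :
  map to_gletter (based_gens ls) = based_word path_to (map gen_letter ls).
Proof.
rewrite /based_word /based_gens map_flatten -!map_comp; congr flatten.
apply: eq_map => -[x|d] /=; rewrite map_cat /= !to_gletter_hidden.
  by [].
by [].
Qed.

Lemma visible_based ls : flatten (map visible (based_gens ls)) = map label ls.
Proof.
elim: ls => //= l ls IH; rewrite /based_gens /= map_cat flatten_cat [flatten _ in X in _ ++ X]IH.
rewrite -cat1s; congr (_ ++ _).
by case: l => [x|d] /=; rewrite map_cat flatten_cat /= !visible_hidden.
Qed.

Lemma based_in_tree ls : all hidden_in_tree (based_gens ls).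
Proof.
elim: ls => //= l ls IH; rewrite /based_gens /= all_cat [X in _ && X]IH andbT.
case: l => [x|d] /=; rewrite all_cat /= (hidden_walk_in_tree (path_toP _)) /=;
  exact: hidden_walk_in_tree (walk_revP (path_toP _)).
Qed.

Lemma based_path ls : is_path base (based_gens ls) base.
Proof.
elim: ls => [|l ls IH] /=; first exact: eqxx.
apply/is_path_catP; exists base => //.
case: l => [x|d] /=; apply/is_path_catP.
  exists (tag x); first exact: hidden_walk_path.
  by rewrite /= eqxx; apply/hidden_walk_path/walk_revP.
exists (dart_origin d); first exact: hidden_walk_path.
by rewrite /= eqxx dart_origin_rev; apply/hidden_walk_path/walk_revP.
Qed.

Lemma gen_class_word ls : word_value (map label ls) = pi1_class T (map gen_letter ls).
Proof. by rewrite pi1_class_seq /word_value !big_map. Qed.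

(** One inclusion is [expands_value]. For the other, the trivial word is completed by hidden tree
    darts; these leave no trace in the output, and the resulting loop is cut into blocks at [base]
    of value 1. *)
Lemma word_problem_expands :
  word_problem pi1_gens = [set w | expands rhs [:: inl NStart] w].
Proof.
rewrite predeqE => w; split; last first.
  by move=> /expands_value; rewrite big_cons big_nil mulg1.
have [ls ->] : exists ls, w = map label ls.
  elim: w => [|a w [ls ->]]; first by exists [::].
  by have [l <-] := label_surj a; exists (l :: ls).
rewrite /word_problem /= gen_class_word => /pi1_classP ls1.
have := based_word_loop acyclic path_toP (to_gletter_based ls) ls1.
move=> /loop_blocks /(_ (based_in_tree ls) _ _ (based_path ls)) [_ [bs [bsw x1]]].
apply: (expands1 (y:=[:: inl (NTrivial base); inl (NLoop (inl base))])).
  by rewrite /= inE.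
rewrite visible_based in bsw; apply: (blocks_target (j:=inl base) bsw).
by apply: vinj_inj; rewrite -x1 /= vprod1 vinj1.
Qed.

Theorem pi1_mcf_word_problem : has_mcf_word_problem (pi1 T).
Proof.
exists pi1_gens; first exact: pi1_gens_symmetric.
rewrite word_problem_expands; exact: nested_substitution_mcf rhs_mcf.
Qed.

End FundamentalGroupGrammar.

Theorem theorem1 (GG : graph_of_groups) (T : {set gedge GG}) :
  spanning_tree T ->
  (forall v : gvertex GG, has_mcf_word_problem (vgroup v)) ->
  (forall e : gedge GG, finite_set [set: egroup e]%classic) ->
  has_mcf_word_problem (pi1 T).
Proof.
move=> [/card_gt0P [base _] conn acyclic] vmcf efin.
pose h v := cid2 (vmcf v).
pose path_to v := sval (cid (conn base v)).
have path_toP v : walk T base (path_to v) v := svalP (cid (conn base v)).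
(* An enumeration of the whole edge group, which makes excursions a finite type. *)
pose X e := sval (cid ((finite_fsetP (A:=[set: egroup e])).1 (efin e))).
have XP e (c : egroup e) : c \in X e.
  have XE : [set: egroup e] = [set` X e] :=
    svalP (cid ((finite_fsetP (A:=[set: egroup e])).1 (efin e))).
  have : [set: egroup e] c by [].
  by rewrite XE.
exact: (@pi1_mcf_word_problem _ T base (fun v => s2val (h v)) (fun v => s2valP (h v))
  X XP (fun v => s2valP' (h v)) acyclic path_to path_toP).
Qed.
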